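(* The periodic+finite global halting prediction problem on $\mathbb Z^3$ is undecidable. That is, there is no algorithm (Turing machine) which, given as input a finite encoding of an arbitrary periodic+finite sandpile configuration $S_0:\mathbb Z^3\to\mathbb Z$, always halts and correctly decides whether there are infinitely many topplings overall in the sandpile process started from $S_0$, i.e. whether $\sum_{v\in\mathbb Z^3}N(v)=\infty$, where $N$ is the odometer function of $S_0$.
   Context: Sandpile process. Let $\mathbb Z^3$ be the cubic lattice graph in which each vertex has six neighbours $v\pm e_i$. A configuration is a function $S_0:\mathbb Z^3\to\mathbb Z$ ($S_0(v)$ is the number of chips initially on $v$). A vertex is unstable if it currently has at least $6$ chips (its degree). Toppling a vertex removes $6$ chips from it and adds one chip to each of its six neighbours. A toppling sequence is a finite (possibly empty) or infinite sequence of vertices, toppled in order starting from $S_0$. It is legal if each vertex toppled is unstable at the moment just before it is toppled, and complete if every vertex that is unstable at some step (including the start) is toppled at some later step. The odometer function $N:\mathbb Z^3\to\mathbb Z_{\ge0}\cup\{\infty\}$ of $S_0$ is: $N(v)$ is the number of times $v$ occurs in a legal complete toppling sequence; such sequences exist and the number does not depend on which one is chosen. Periodic+finite configurations. A configuration $P:\mathbb Z^3\to\mathbb Z$ is periodic if there are integers $n_x,n_y,n_z\ge1$ such that $P(x,y,z)=P(x',y',z')$ whenever $x\equiv x' \bmod n_x$, $y\equiv y'\bmod n_y$, $z\equiv z'\bmod n_z$. A periodic+finite configuration is $S_0=P+F$ with $P$ periodic and $F:\mathbb Z^3\to\mathbb Z_{\ge0}$ of finite support (finitely many added chips). Its finite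 encoding consists of $n_x,n_y,n_z$, the values of $P$ on $\{0,\dots,n_x-1\}\times\{0,\dots,n_y-1\}\times\{0,\dots,n_z-1\}$, and the finite list of pairs $(v,F(v))$ with $F(v)\neq0$. *)

(* Defs.v *)
From HB Require Import structures.
From Corelib Require Import BinNums.
From mathcomp Require Import all_boot all_order all_algebra.
From mathcomp Require Import constructive_ereal.

Set Implicit Arguments.
Unset Strict Implicit.
Unset Printing Implicit Defensive.

Import Order.TTheory GRing.Theory Num.Theory.
Local Open Scope ring_scope.

(** * The sandpile process on Z^3 *)

Definition vertex : Type := (int * int * int)%type.

Definition neighbours (v : vertex) : seq vertex :=
  let: (x, y, z) := v in
  [:: (x + 1, y, z); (x - 1, y, z);
      (x, y + 1, z); (x, y - 1, z);
      (x, y, z + 1); (x, y, z - 1)].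

Definition configuration : Type := vertex -> int.

Definition unstable (S : configuration) (v : vertex) : bool := 6 <= S v.

Definition topple (S : configuration) (v : vertex) : configuration :=
  fun w => S w - (if w == v then 6 else 0)
               + (if w \in neighbours v then 1 else 0).

Inductive toppling_seq : Type :=
  | FiniteSeq of seq vertex
  | InfiniteSeq of (nat -> vertex).

Definition entry (s : toppling_seq) (i : nat) : option vertex :=
  match s with
  | FiniteSeq l => onth l i
  | InfiniteSeq u => Some (u i)
  end.

(* The configuration just before entry [i] of [s] is toppled; once a finite
   sequence is exhausted, it stays equal to the final configuration. *)
Fixpoint state (S0 : configuration) (s : toppling_seq) (i : nat)
    : configuration :=
  if i is j.+1 then
    if entry s j is Some v then topple (state S0 s j) v else state S0 s j
  else S0.

Definition legal (S0 : configuration) (s : toppling_seq) : Prop :=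
  forall i v, entry s i = Some v -> unstable (state S0 s i) v.

Definition complete (S0 : configuration) (s : toppling_seq) : Prop :=
  forall i v, unstable (state S0 s i) v ->
    exists j : nat, (i <= j)%N /\ entry s j = Some v.

Definition occurrences (s : toppling_seq) (v : vertex) (n : \bar int) : Prop :=
  (exists r : seq nat,
     [/\ uniq r,
         forall i, i \in r <-> entry s i = Some v
       & n = ((size r)%:Z)%:E])
  \/ ((forall m : nat, exists i : nat, (m <= i)%N /\ entry s i = Some v)
      /\ n = +oo%E).

(* The odometer takes its values in the part {0, 1, 2, ...} U {+oo} of
   [\bar int]. *)
Definition is_odometer (S0 : configuration) (N : vertex -> \bar int) : Prop :=
  exists s : toppling_seq,
    [/\ legal S0 s, complete S0 s & forall v, occurrences s v (N v)].

(* For [N] with values in {0, 1, 2, ...} U {+oo}: the sum of [N] over Z^3, i.e.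
   the supremum of its finite partial sums, is +oo. *)
Definition infinite_sum (N : vertex -> \bar int) : Prop :=
  forall k : nat, exists l : seq vertex,
    uniq l /\ ((k%:Z)%:E <= \sum_(v <- l) N v)%E.

Definition infinitely_many_topplings (S0 : configuration) : Prop :=
  exists N : vertex -> \bar int, is_odometer S0 N /\ infinite_sum N.

(** * Periodic+finite configurations and their finite encodings *)

Definition periodic (nx ny nz : nat) (P : configuration) : Prop :=
  forall x y z x' y' z' : int,
    (x = x' %[mod nx])%Z -> (y = y' %[mod ny])%Z -> (z = z' %[mod nz])%Z ->
    P (x, y, z) = P (x', y', z').

(* [pf_support] lists the support of [pf_finite] in an arbitrary order, which
   is the order used by the encoding. The periods need not be minimal. *)
Record pf_config : Type := PFConfig {
  pf_nx : nat;
  pf_ny : nat;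
  pf_nz : nat;
  pf_periodic : configuration;
  pf_finite : vertex -> nat;
  pf_support : seq vertex;
  pf_nx_gt0 : (0 < pf_nx)%N;
  pf_ny_gt0 : (0 < pf_ny)%N;
  pf_nz_gt0 : (0 < pf_nz)%N;
  pf_periodicP : periodic pf_nx pf_ny pf_nz pf_periodic;
  pf_support_uniq : uniq pf_support;
  pf_supportP : forall v, (v \in pf_support) = (pf_finite v != 0%N)
}.

Definition pf_initial (I : pf_config) : configuration :=
  fun v => pf_periodic I v + (pf_finite I v)%:Z.

Inductive letter : Type := Bit of bool | Minus | Separator.

Fixpoint positive_bits (p : positive) : seq letter :=
  match p with
  | xH => [:: Bit true]
  | xO q => Bit false :: positive_bits q
  | xI q => Bit true :: positive_bits q
  end.

(* Binary, least significant bit first, no leading zeros, 0 being the empty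
   word. *)
Definition nat_bits (n : nat) : seq letter :=
  if bin_of_nat n is Npos p then positive_bits p else [::].

Definition encode_int (n : int) : seq letter :=
  (if n < 0 then [:: Minus] else [::]) ++ nat_bits `|n|%N ++ [:: Separator].

Definition pf_data (I : pf_config) : seq int :=
  [:: (pf_nx I)%:Z; (pf_ny I)%:Z; (pf_nz I)%:Z]
  ++ flatten [seq flatten [seq [seq pf_periodic I (x%:Z, y%:Z, z%:Z)
                               | z <- iota 0 (pf_nz I)]
                          | y <- iota 0 (pf_ny I)]
             | x <- iota 0 (pf_nx I)]
  ++ flatten [seq [:: v.1.1; v.1.2; v.2; (pf_finite I v)%:Z]
             | v <- pf_support I].

Definition encode (I : pf_config) : seq letter :=
  flatten [seq encode_int n | n <- pf_data I].

(** * Deterministic Turing machines with one two-way infinite tape *)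

Inductive move : Type := MoveLeft | MoveRight | Stay.

Definition shift (d : move) (h : int) : int :=
  match d with
  | MoveLeft => h - 1
  | MoveRight => h + 1
  | Stay => h
  end.

(* [tm_embed] injects the input letters ([Some a]) and the blank ([None])
   into the tape alphabet [tm_symbol]. *)
Record turing_machine (A : Type) : Type := TuringMachine {
  tm_state : finType;
  tm_symbol : finType;
  tm_embed : option A -> tm_symbol;
  tm_embed_inj : injective tm_embed;
  tm_start : tm_state;
  tm_accept : tm_state;
  tm_reject : tm_state;
  tm_accept_neq_reject : tm_accept != tm_reject;
  tm_delta : tm_state -> tm_symbol -> tm_state * tm_symbol * move
}.

Section Run.

Variables (A : Type) (M : turing_machine A).

Record tm_config : Type := TMConfig {
  cfg_state : tm_state M;
  cfg_head : int;
  cfg_tape : int -> tm_symbol M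
}.

Definition tm_halted (c : tm_config) : bool :=
  (cfg_state c == tm_accept M) || (cfg_state c == tm_reject M).

Definition tm_step (c : tm_config) : tm_config :=
  if tm_halted c then c else
  let: (q, a, d) := tm_delta (cfg_state c) (cfg_tape c (cfg_head c)) in
  TMConfig q (shift d (cfg_head c))
    (fun i => if i == cfg_head c then a else cfg_tape c i).

Definition tm_init (w : seq A) : tm_config :=
  TMConfig (tm_start M) 0
    (fun i => tm_embed M (if i is Posz n then onth w n else None)).

Definition tm_accepts (w : seq A) : Prop :=
  exists t : nat, cfg_state (iter t tm_step (tm_init w)) = tm_accept M.

Definition tm_rejects (w : seq A) : Prop :=
  exists t : nat, cfg_state (iter t tm_step (tm_init w)) = tm_reject M.

End Run.

(* Nothing is required of [M] on words that encode no instance. *)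
Definition tm_decides (A : Type) (M : turing_machine A)
    (I : Type) (enc : I -> seq A) (yes : I -> Prop) : Prop :=
  forall i : I,
    (yes i /\ tm_accepts M (enc i)) \/ (~ yes i /\ tm_rejects M (enc i)).

Definition undecidable (A I : Type) (enc : I -> seq A) (yes : I -> Prop)
    : Prop :=
  ~ exists M : turing_machine A, tm_decides M enc yes.

(* Main.v *)
(** If every vertex topples at most once, heights act as thresholds: a vertex of
    height [6 - k] topples as soon as [k] of its neighbours have. Vertices of
    height 5 form wires, vertices of height -1 insulate, and a vertex of height 2
    with two neighbours on a wire [a], two on a wire [b] and one on a wire [c]
    computes [c := a /\ b] without ever feeding back from [c]. Using the third
    dimension for crossings, every periodic system of Horn clauses over a
    two-dimensional array of cells can thus be wired up, and the toppled set is
    its least model.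

    Such a system draws the space-time diagram of a Turing machine [M], one
    step per row. Each step is triggered by the head, from which waves copy the
    tape to the next row up to two end markers, so that everything stops when
    [M] halts. The input of [M] is read from a ROM: for each letter [a] the cells
    contain one gate that is present exactly in the cells whose ROM letter is
    [a]. A single added chip starts the process.

    Listed in the order of the encoding, all cells have the same description but
    for the ROM gates. So, if a decider [D] existed, a machine [M] whose input [w]
    contains the description of a cell with holes at the ROM gates (a finite
    string depending on [M]) could write down the encoding of the configuration
    simulating [M] on [w] itself, run [D] on it, and do the opposite. *)

Require Import Defs.
From HB Require Import structures.
From mathcomp Require Import all_boot all_order all_algebra.
From mathcomp Require Import constructive_ereal zify.
From Stdlib Require Import Classical ClassicalEpsilon FunctionalExtensionality.

Set Implicit Arguments.
Unset Strict Implicit.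
Unset Printing Implicit Defensive.

Import Order.TTheory GRing.Theory Num.Theory.
Local Open Scope ring_scope.

(** * Topplings as threshold percolation *)

(** Topplings are bounded from above by a set of vertices that stabilises the configuration when
    each of them topples once, and from below by vertices that every complete sequence has to
    topple. Models of the rules supply the former, derivations the latter. The delicate side is the
    upper bound: wires conduct both ways, so a false variable must be shielded from every true one.

    The axes have different tasks: x is the tape and the ROM, z is time, y gives room to the buses.
    The period is thus one cell in y and z, and as many cells in x as the input has letters. The ROM
    repeats along x, so the input must announce its own end: its last letter occurs nowhere else in
    it.

    Self-reference needs no recursion theorem, because the wiring depends on the machine alone and
    the input enters only through the ROM. One circularity remains: the encoding opens with the
    x-period, hence with the length of the very input that must contain it. Padding resolves this,
    since numerals are only logarithmically long. *)

Definition toppling_count (s : toppling_seq) (i : nat) (v : vertex) : nat :=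
  count (fun j => entry s j == Some v) (iota 0 i).

Lemma toppling_count_succ s i v
  : toppling_count s i.+1 v = (toppling_count s i v + (entry s i == Some v))%N.
Proof. by rewrite /toppling_count -addn1 iotaD count_cat /= addn0. Qed.

Lemma neighbours_sym v w : (v \in neighbours w) = (w \in neighbours v).
Proof.
suff H a b : a \in neighbours b -> b \in neighbours a by apply/idP/idP; apply: H.
case: b => [[x y] z]; rewrite !inE.
by move=> /or4P [|||/or3P []] /eqP ->; rewrite !inE ?addrK ?subrK eqxx ?orbT.
Qed.

Lemma neighbours_uniq v : uniq (neighbours v).
Proof. by case: v => [[x y] z]; rewrite /= !inE !xpair_eqE; lia. Qed.

Lemma stateE S0 s i v :
  state S0 s i v = S0 v - (6 * toppling_count s i v)%N%:Z
                   + (\sum_(u <- neighbours v) toppling_count s i u)%N%:Z.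
Proof.
elim: i => [|i IH] /=; first by rewrite big1 // subr0 addr0.
rewrite toppling_count_succ; under eq_bigr do rewrite toppling_count_succ.
rewrite big_split /=; case: (entry s i) => [w|]; last first.
  by rewrite /= big1_eq !addn0 IH.
rewrite /topple IH.
have -> : (\sum_(u <- neighbours v) (Some w == Some u :> option vertex))%N = (w \in
  neighbours v).
  rewrite -big_mkcondr sum1_count -(count_uniq_mem _ (neighbours_uniq v)).
  by apply: eq_count => u /=; rewrite eq_sym.
rewrite neighbours_sym; have -> : (Some w == Some v) = (v == w) by rewrite eq_sym.
by case: (v == w); case: (w \in _); lia.
Qed.

Section AtMostOnce.

Variables (S0 : configuration) (T : pred vertex).
Hypothesis T_closed :
  forall v, S0 v + (count T (neighbours v))%:Z < 6 + 6 * (T v : nat)%:Z.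

(** Least action: [T_closed] says that toppling each vertex of [T] once leaves every height below 6,
    so [v] cannot legally exceed [T v] while its neighbours respect their own bounds. *)
Lemma toppling_count_le s : legal S0 s -> forall i v, (toppling_count s i v <= T v)%N.
Proof.
move=> Hs; elim=> [//|i IH] v; rewrite toppling_count_succ.
case: eqP => [E|_]; last by rewrite addn0.
have := Hs i v E; rewrite /unstable stateE.
have : (\sum_(u <- neighbours v) toppling_count s i u <= count T (neighbours v))%N.
  rewrite -sum1_count [leqRHS]big_mkcond /=; apply: leq_sum => u _.
  by have := IH u; case: (T u).
have := T_closed v; lia.
Qed.

Lemma occurrences_le s v n : legal S0 s -> occurrences s v n ->
  exists2 k : nat, n = (k%:Z)%:E & (k <= T v)%N.
Proof.
move=> Hs [[r [Ur Hr ->]]|[Hinf _]].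
  exists (size r) => //; set m := (\max_(i <- r) i).+1.
  apply: leq_trans (toppling_count_le Hs m v); rewrite /toppling_count -size_filter.
  apply: uniq_leq_size => // i ir; rewrite mem_filter mem_iota /= add0n.
  apply/andP; split; first by apply/eqP/Hr.
  by rewrite ltnS; apply: leq_bigmax_seq.
exfalso; have [i [_ Ei]] := Hinf 0%N; have [j [ij Ej]] := Hinf i.+1.
have := toppling_count_le Hs j.+1 v; rewrite toppling_count_succ Ej eqxx.
have : (0 < toppling_count s j v)%N.
  rewrite -has_count; apply/hasP; exists i; last by rewrite Ei.
  by rewrite mem_iota.
by case: (T v); lia.
Qed.

Lemma finitely_many_topplings (l : seq vertex) :
  (forall v, T v -> v \in l) -> ~ infinitely_many_topplings S0.
Proof.
move=> Tl [N [[s [Hs _ Hocc]] /(_ (size l).+1) [l' [Ul' Hsum]]]].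
have bound : (\sum_(v <- l') N v <= ((count T l')%:Z)%:E)%E.
  elim: l' {Ul' Hsum} => [|v l' IH]; first by rewrite big_nil.
  rewrite big_cons /= PoszD EFinD; apply: leeD => //.
  by have [k -> kT] := occurrences_le Hs (Hocc v); rewrite lee_fin.
have := le_trans Hsum bound; rewrite lee_fin -size_filter.
have : (size (filter T l') <= size l)%N.
  apply: uniq_leq_size; first exact: filter_uniq.
  by move=> v; rewrite mem_filter => /andP [/Tl].
lia.
Qed.

Inductive forced : vertex -> Prop :=
  | Forced v (l : seq vertex) :
      uniq l -> {subset l <= neighbours v} -> (forall u, u \in l -> forced u) ->
      6 <= S0 v + (size l)%:Z -> forced v.

(** Once all of [l] has toppled, [v] either has toppled too or has lost no chip and is unstable, so
    completeness topples it. The bound [i <= j] allows the members of [l] to be awaited one after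
    the other. *)
Lemma forced_toppled s v i : legal S0 s -> complete S0 s -> forced v ->
  exists j, (i <= j)%N /\ (0 < toppling_count s j v)%N.
Proof.
move=> Hs Hc Fv; elim: Fv i => {v} v l Ul ln _ IH Hv i.
have [i' [ii' Hi']] : exists i', (i <= i')%N /\
    forall u, u \in l -> (0 < toppling_count s i' u)%N.
  elim: l {Ul ln Hv} IH => [|u l IHl] IH; first by exists i.
  have [|i1 [ii1 Hi1]] := IHl; first by move=> w wl; apply: IH; rewrite inE wl orbT.
  have [|i2 [i12 Hi2]] := IH u _ i1; first by rewrite inE eqxx.
  exists i2; split; first exact: leq_trans i12.
  move=> w; rewrite inE => /orP [/eqP -> //|/Hi1 w1].
  by apply: leq_trans w1 _; rewrite /toppling_count -(subnK i12) addnC iotaD count_cat leq_addr.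
case: (posnP (toppling_count s i' v)) => [t0|]; last by exists i'.
have : unstable (state S0 s i') v.
  rewrite /unstable stateE t0.
  suff : (size l <= \sum_(u <- neighbours v) toppling_count s i' u)%N by lia.
  apply: (@leq_trans (\sum_(u <- neighbours v | u \in l) 1)%N).
    rewrite sum1_count -size_filter; apply: uniq_leq_size => // u ul.
    by rewrite mem_filter ul; apply: ln.
  rewrite big_mkcond; apply: leq_sum => u _; case: ifP => // ul; exact: Hi'.
move=> /Hc [j [ij Ej]]; exists j.+1; rewrite toppling_count_succ Ej eqxx; split; lia.
Qed.

(* Always toppling the unstable vertex of least code is fair, because no vertex
   topples twice. *)
Definition unstable_code (S : configuration) (n : nat) : bool :=
  if pickle_inv n is Some v then unstable S v else false.

Definition least_unstable (S : configuration) : option vertex :=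
  match excluded_middle_informative (exists n, unstable_code S n) with
  | left H => pickle_inv (ex_minn H)
  | right _ => None
  end.

Lemma least_unstable_some S v : least_unstable S = Some v ->
  unstable S v /\ forall w, unstable S w -> (pickle v <= pickle w)%N.
Proof.
rewrite /least_unstable; case: excluded_middle_informative => // H.
case: ex_minnP => n + Hmin E; rewrite /unstable_code E => Hv; split=> // w Hw.
have <- : n = pickle v by have := @pickle_invK vertex n; rewrite E.
by apply: Hmin; rewrite /unstable_code pickleK_inv.
Qed.

Lemma least_unstable_none S v : least_unstable S = None -> ~~ unstable S v.
Proof.
rewrite /least_unstable; case: excluded_middle_informative => [H|H _].
  case: ex_minnP => n; rewrite /unstable_code; by case: pickle_inv.
by apply/negP => Hv; apply: H; exists (pickle v); rewrite /unstable_code pickleK_inv.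
Qed.

Fixpoint greedy (i : nat) : configuration :=
  if i is j.+1 then
    if least_unstable (greedy j) is Some v then topple (greedy j) v else greedy j
  else S0.

Definition greedy_entry i : vertex :=
  odflt (0, 0, 0) (least_unstable (greedy i)).

Definition greedy_seq : toppling_seq := InfiniteSeq greedy_entry.

Definition greedy_prefix i : toppling_seq := FiniteSeq (mkseq greedy_entry i).

Lemma state_greedy_prefix i :
  (forall j, (j < i)%N -> least_unstable (greedy j)) ->
  forall j, (j <= i)%N -> state S0 (greedy_prefix i) j = greedy j.
Proof.
move=> Hi; elim=> [//|j IH] ji /=; rewrite IH ?(ltnW ji) //.
rewrite onthE (nth_map (0, 0, 0)) ?size_mkseq // nth_mkseq // /greedy_entry.
by have := Hi j ji; case: least_unstable.
Qed.

Lemma legal_greedy_prefix i :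
  (forall j, (j < i)%N -> least_unstable (greedy j)) -> legal S0 (greedy_prefix i).
Proof.
move=> Hi j v /= Ej.
have ji : (j < i)%N by rewrite -(size_mkseq greedy_entry i) -onthTE Ej.
rewrite state_greedy_prefix ?(ltnW ji) //.
move: Ej; rewrite onthE (nth_map (0, 0, 0)) ?size_mkseq // nth_mkseq // => -[<-].
rewrite /greedy_entry; have := Hi j ji; case E: least_unstable => [w|//] _ /=.
by have [] := least_unstable_some E.
Qed.

Hypothesis many_forced :
  forall k, exists l : seq vertex, [/\ uniq l, size l = k & forall v, v \in l -> forced v].

(** If the greedy process stopped at stage [i], its first [i] entries would be a legal complete
    sequence and so contain every forced vertex; but there are at least [i + 1] of these. *)
Lemma least_unstable_greedy i : least_unstable (greedy i).
Proof.
elim/ltn_ind: i => i Hi.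
case E: (least_unstable (greedy i)) => //; exfalso.
have Hl := legal_greedy_prefix Hi.
have Hs j : state S0 (greedy_prefix i) (i + j) = greedy i.
  elim: j => [|j IH]; first by rewrite addn0 state_greedy_prefix.
  by rewrite addnS /= IH onth_default // size_mkseq leq_addr.
(* An unstable vertex stays unstable until it topples, whereas the final configuration is stable. *)
have Hc : complete S0 (greedy_prefix i).
  move=> j v Hv; have [ij|ji] := leqP i j.
    by move: Hv; rewrite -(subnKC ij) Hs (negbTE (least_unstable_none v E)).
  apply: NNPP => Hn; have := least_unstable_none v E.
  suff H k : unstable (state S0 (greedy_prefix i) (j + k)) v.
    by have := H (i - j)%N; rewrite (subnKC (ltnW ji)) -[X in state _ _ X]addn0 Hs => ->.
  elim: k => [|k IH]; first by rewrite addn0.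
  rewrite addnS /=; case Ew: onth => [w|//].
  move: IH; rewrite /unstable /topple; case: eqP => [Evw|_].
    case: Hn; exists (j + k)%N; split; first exact: leq_addr.
    by rewrite /= Ew Evw.
  by case: ifP => _; lia.
have [l [Ul szl Fl]] := many_forced i.+1.
suff : (size l <= i)%N by rewrite szl ltnn.
rewrite -[leqRHS](size_mkseq greedy_entry); apply: uniq_leq_size => // v /Fl Fv.
have [j [_]] := forced_toppled 0 Hl Hc Fv.
rewrite -has_count => /hasP [k _ /eqP /=].
rewrite onthE => Ek.
have ki : (k < size (map Some (mkseq greedy_entry i)))%N.
  by rewrite ltnNge; apply/negP => /(nth_default None); rewrite Ek.
have := mem_nth None ki; rewrite Ek => /mapP [w wi [->]]; exact: wi.
Qed.

Lemma state_greedy i : state S0 greedy_seq i = greedy i.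
Proof.
elim: i => [//|i IH] /=; rewrite IH /greedy_entry.
by have := least_unstable_greedy i; case: least_unstable.
Qed.

Lemma greedy_entryP i : unstable (greedy i) (greedy_entry i) /\
  forall w, unstable (greedy i) w -> (pickle (greedy_entry i) <= pickle w)%N.
Proof.
rewrite /greedy_entry; have := least_unstable_greedy i.
by case E: least_unstable => [v|//] _; apply: least_unstable_some.
Qed.

Lemma legal_greedy : legal S0 greedy_seq.
Proof. by move=> i v [<-]; rewrite state_greedy; case: (greedy_entryP i). Qed.

Lemma greedy_entry_inj : injective greedy_entry.
Proof.
suff H i j : (i < j)%N -> greedy_entry i <> greedy_entry j.
  by move=> i j E; case: (ltngtP i j) => // /H; rewrite E.
move=> ij E; have := toppling_count_le legal_greedy j.+1 (greedy_entry j).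
rewrite toppling_count_succ /= eqxx.
have : (0 < toppling_count greedy_seq j (greedy_entry j))%N.
  rewrite -has_count; apply/hasP; exists i; last by rewrite /= E.
  by rewrite mem_iota.
by case: (T _); lia.
Qed.

Lemma complete_greedy : complete S0 greedy_seq.
Proof.
move=> i v Hv; apply: NNPP => Hn.
have Hun k : unstable (greedy (i + k)) v.
  rewrite -state_greedy; elim: k => [|k IH]; first by rewrite addn0.
  rewrite addnS /=; move: IH; rewrite /unstable /topple; case: eqP => [Evw|_].
    by case: Hn; exists (i + k)%N; rewrite leq_addr /= Evw.
  by case: ifP => _; lia.
have Hp k : (pickle (greedy_entry (i + k)) <= pickle v)%N.
  by have [_] := greedy_entryP (i + k); apply; apply: Hun.
(* Pigeonhole: the entries from stage [i] on are distinct and, while [v] waits, have codes at most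
   [pickle v]. *)
have : (size (mkseq (fun k => pickle (greedy_entry (i + k))) (pickle v).+2)
         <= size (iota 0 (pickle v).+1))%N.
  apply: uniq_leq_size; last first.
    by move=> n /mapP [k _ ->]; rewrite mem_iota /= add0n ltnS Hp.
  apply/mkseq_uniqP => a b _ _ /(pcan_inj pickleK) /greedy_entry_inj; lia.
by rewrite size_mkseq size_iota ltnn.
Qed.

Lemma infinitely_many_of_forced : infinitely_many_topplings S0.
Proof.
pose hit v := exists i, greedy_entry i = v.
pose N v : \bar int := if excluded_middle_informative (hit v) then 1%:E else 0%:E.
exists N; split.
  exists greedy_seq; split; [exact: legal_greedy|exact: complete_greedy|].
  move=> v; left; rewrite /N; case: excluded_middle_informative => [[i Ei]|Hn].
    exists [:: i]; split=> // j; rewrite inE /= -Ei; split=> [/eqP -> //|].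
    by case=> /greedy_entry_inj ->.
  by exists [::]; split=> // i; split=> // -[E]; case: Hn; exists i.
move=> k; have [l [Ul szl Fl]] := many_forced k; exists l; split=> //.
rewrite -szl; elim: l {Ul szl} Fl => [|v l IH] Fl; first by rewrite big_nil.
rewrite big_cons /= -add1n PoszD EFinD; apply: leeD; last first.
  by apply: IH => u ul; apply: Fl; rewrite inE ul orbT.
rewrite /N; case: excluded_middle_informative => // Hn; case: Hn.
have /(forced_toppled 0 legal_greedy complete_greedy) [j [_]] :
  forced v by apply: Fl; rewrite inE eqxx.
by rewrite -has_count => /hasP [i _ /eqP [E]]; exists i.
Qed.

End AtMostOnce.

(** * Laying out a periodic Horn program in Z^3 *)

(* The rule [(a, b, c, up)] of the cell [(c0, j, t)] reads "a and b imply c", where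
   the port [2 * v + d] stands for the variable [v] of the cell [(c0 - d, j, t)];
   the conclusion is moved to the cells at [t + 1] if [up] holds. *)
Record rule := Rule { rule_a : nat; rule_b : nat; rule_c : nat; rule_up : bool }.

(** A wire is labelled with a port of its own cell, so one net bears different labels in different
    cells; the flag marks a conclusion bound for the next cell in time. A gate is labelled with its
    rule. *)
Inductive kind := Inert | Wire of nat & bool | Gate of nat.

Definition local_coord (n : nat) (x : int) : nat := `|(x %% n)%Z|%N.

Lemma local_coord_lt n x : (0 < n)%N -> (local_coord n x < n)%N.
Proof. rewrite /local_coord; lia. Qed.

Lemma local_coord_succ n x : (0 < n)%N ->
  ((local_coord n x).+1 < n)%N /\ local_coord n (x + 1) = (local_coord n x).+1 /\
    ((x + 1) %/ n)%Z = (x %/ n)%Z \/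
  (local_coord n x).+1 = n /\ local_coord n (x + 1) = 0%N /\
    ((x + 1) %/ n)%Z = (x %/ n)%Z + 1.
Proof.
move=> n0; rewrite /local_coord; have := divz_eq x n; have : (x %% n)%Z < n by lia.
have : 0 <= (x %% n)%Z by lia.
set q := (x %/ n)%Z; set r := (x %% n)%Z => r0 rn ->.
have [r1|r1] := boolP (r + 1 < n).
  left; rewrite -addrA modzMDl divzMDl; last by lia.
  rewrite modz_small ?divz_small; lia.
right; have -> : q * n + r + 1 = (q + 1) * n + 0 by lia.
rewrite modzMDl divzMDl; last by lia.
by rewrite mod0z div0z; lia.
Qed.

Lemma local_coordE (n : nat) (c : int) (k : nat) : (k < n)%N ->
  local_coord n (c * n + k%:Z) = k /\ ((c * n + k%:Z) %/ n)%Z = c.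
Proof.
move=> kn; rewrite /local_coord modzMDl divzMDl; last by lia.
by rewrite modz_small ?divz_small; lia.
Qed.

(** * The wiring of a cell *)

Section Layout.

Variables (nv : nat) (rules : seq rule).

Definition the_rule r := nth (Rule 0 0 0 false) rules r.
(** The two extra columns leave room for the jogs of the buses. The four extra rows hold the gates
    at [gate_y], wires in the row before and the row after them, and a last inert row. *)
Definition width := (6 * size rules + 2)%N.
Definition depth := (4 * nv + 4)%N.
Definition gate_y := (4 * nv + 1)%N.

(* A cell is a box [width] x [depth] x 6. Layer 0 contains one bus per variable; it
   occupies the row [4 * v] of its own cell, ends with a jog and continues in the
   row [4 * v + 2] of the next cell, so that the port [p] is available in the row
   [2 * p]. The rule [r] owns the columns [6 * r .. 6 * r + 5]: the inputs go up to
   layer 2 and run in columns 0 and 4 to its gate, in column 2 at [gate_y]; the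
   output leaves the gate upwards, runs back in layer 4 and goes down to its bus,
   or up to the bus of the next cell. *)
Definition bus_kind (x y : nat) : kind :=
  if (y < 4 * nv)%N then
    match (y %% 4)%N with
    | 0%N => if (x + 2 <= width)%N then Wire (y %/ 2) false else Inert
    | 1%N => if (x + 2 == width)%N then Wire (y %/ 2) false else Inert
    | 2%N => if (x + 4 <= width)%N then Wire (y %/ 2) false
             else if (width <= x + 2)%N then Wire (y %/ 2).-1 false else Inert
    | _ => Inert
    end
  else Inert.

(** Odd layers contain only isolated vertical pins, so runs in layers 0, 2 and 4 cross without
    touching. Columns 1 and 3 lead each input around a corner, so that it touches the gate on two
    sides. Column 5 separates consecutive rules. *)
Definition column_kind (r s y z : nat) : kind :=
  let: Rule a b c up := the_rule r in
  match z, s with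
  | 1%N, 0%N => if y == (2 * a)%N then Wire a false else Inert
  | 1%N, 2%N => if (y == 2 * c)%N && ~~ up then Wire c false else Inert
  | 1%N, 4%N => if y == (2 * b)%N then Wire b false else Inert
  | 2%N, 0%N => if (2 * a <= y <= gate_y)%N then Wire a false else Inert
  | 2%N, 1%N => if (4 * nv <= y <= gate_y)%N then Wire a false else Inert
  | 2%N, 2%N => if y == (4 * nv)%N then Wire a false
                else if y == gate_y then Gate r
                else if y == gate_y.+1 then Wire b false
                else if (y == 2 * c)%N && ~~ up then Wire c false else Inert
  | 2%N, 3%N => if (gate_y <= y <= gate_y.+1)%N then Wire b false else Inert
  | 2%N, 4%N => if (2 * b <= y <= gate_y)%N then Wire b false else Inert
  | 3%N, 2%N => if (y == gate_y) || ((y == 2 * c)%N && ~~ up) then Wire c up else Inert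
  | 4%N, 2%N => if (2 * c <= y <= gate_y)%N then Wire c up else Inert
  | 5%N, 2%N => if (y == 2 * c)%N && up then Wire c up else Inert
  | _, _ => Inert
  end.

Definition local_kind (x y z : nat) : kind :=
  if z is 0%N then bus_kind x y
  else if (x %/ 6 < size rules)%N then column_kind (x %/ 6) (x %% 6) y z else Inert.

Definition well_formed := forall r, (r < size rules)%N ->
  [/\ (rule_a (the_rule r) < 2 * nv)%N, (rule_b (the_rule r) < 2 * nv)%N
    & (rule_c (the_rule r) < 2 * nv)%N].

(** * Nets, and the check that adjacent vertices agree *)

Definition fact : Type := nat * int * int * int.

Definition port_fact (c j t : int) (p : nat) (up : bool) : fact :=
  ((p %/ 2)%N, c - (p %% 2)%N%:Z, j, t + (up : nat)%:Z).

Definition rule_input_a c j t r := port_fact c j t (rule_a (the_rule r)) false.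
Definition rule_input_b c j t r := port_fact c j t (rule_b (the_rule r)) false.
Definition rule_output c j t r :=
  port_fact c j t (rule_c (the_rule r)) (rule_up (the_rule r)).

(** The design rule of the layout: touching wires carry one fact, a gate touches only its own nets,
    and two gates never touch. Both cells are arguments because a net may change its label at a cell
    border. *)
Definition compatible c j t (k : kind) c' j' t' (k' : kind) : Prop :=
  match k, k' with
  | Wire p up, Wire p' up' => port_fact c j t p up = port_fact c' j' t' p' up'
  | Wire p up, Gate r =>
    [\/ port_fact c j t p up = rule_input_a c' j' t' r,
        port_fact c j t p up = rule_input_b c' j' t' r
      | port_fact c j t p up = rule_output c' j' t' r]
  | Gate r, Wire p up =>
    [\/ port_fact c' j' t' p up = rule_input_a c j t r,
        port_fact c' j' t' p up = rule_input_b c j t r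
      | port_fact c' j' t' p up = rule_output c j t r]
  | Gate _, Gate _ => False
  | _, _ => True
  end.

Lemma compatible_inert c j t k c' j' t' : compatible c j t k c' j' t' Inert.
Proof. by case: k. Qed.

Hypothesis wf : well_formed.

Lemma compatible_x c j t x y z : (x.+1 < width)%N -> (z < 6)%N ->
  compatible c j t (local_kind x y z) c j t (local_kind x.+1 y z).
Proof.
move=> xw; rewrite /local_kind; case: z => [_|z z6].
  rewrite /bus_kind; case: ifP => // yv.
  case: (y %% 4)%N => [|[|[|]]] //; repeat case: ifP => ? //=; lia.
case: ifP => // rR; have := wf rR; set r := (x %/ 6)%N.
have [x6|x6] := eqVneq (x %% 6)%N 5%N.
  rewrite /column_kind x6; case: (the_rule r) => a b cc up _.
  by case: z {z6} => [|[|[|[|[|]]]]].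
have -> : (x.+1 %/ 6)%N = r by rewrite /r; lia.
have -> : (x.+1 %% 6)%N = (x %% 6).+1 by lia.
rewrite rR /column_kind; case E: (the_rule r) => [a b cc up] /= [Ha Hb Hc].
have : (x %% 6 < 6)%N by lia.
case: z z6 => [|[|[|[|[|]]]]] // _; case: (x %% 6)%N => [|[|[|[|[|[|]]]]]] // _;
  repeat case: ifP => ? //=; rewrite /rule_input_a /rule_input_b ?E /=;
  try solve [by constructor 1|by constructor 2|by constructor 3]; unfold gate_y in *; lia.
Qed.

Lemma port_fact_odd c j t v
  : port_fact (c + 1) j t (2 * v).+1 false = port_fact c j t (2 * v) false.
Proof.
rewrite /port_fact; have -> : ((2 * v).+1 %/ 2 = v)%N by lia.
have -> : ((2 * v).+1 %% 2 = 1)%N by lia.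
have -> : ((2 * v) %/ 2 = v)%N by lia.
have -> : ((2 * v) %% 2 = 0)%N by lia.
by congr (_, _, _, _); lia.
Qed.

(** Above layer 0 the last column is inert, so only buses cross this border. *)
Lemma compatible_x_wrap c j t x y z : x.+1 = width -> (0 < size rules)%N -> (z < 6)%N ->
  compatible c j t (local_kind x y z) (c + 1) j t (local_kind 0 y z).
Proof.
move=> xw R0; have w8 : (8 <= width)%N by unfold width; lia.
rewrite /local_kind; case: z => [_|z z6].
  rewrite /bus_kind; case: ifP => // yv; have : (y %% 4 < 4)%N by lia.
  have := divn_eq y 4; set q := (y %/ 4)%N.
  case: (y %% 4)%N => [|[|[|[|]]]] // Hy _; do !case: ifP => ? //=; try lia.
  (* The jogged bus is relabelled here: port [2 * q] of cell [c] is port [2 * q + 1] of cell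
     [c + 1]. *)
  have -> : (y %/ 2 = (2 * q).+1)%N by lia.
  by rewrite port_fact_odd.
have -> : (x %/ 6 < size rules)%N = false by unfold width in xw; lia.
by [].
Qed.

Lemma compatible_y c j t x y z : (z < 6)%N ->
  compatible c j t (local_kind x y z) c j t (local_kind x y.+1 z).
Proof.
rewrite /local_kind; case: z => [_|z z6].
  rewrite /bus_kind; case: ifP => // yv.
  have : (y %% 4 < 4)%N by lia.
  have := divn_eq y 4; set q := (y %/ 4)%N.
  case: (y %% 4)%N => [|[|[|[|]]]] // Hy _.
  - have -> : (y.+1 < 4 * nv)%N by lia.
    have -> : (y.+1 %% 4 = 1)%N by lia.
    do !case: ifP => ? //=; have -> : (y.+1 %/ 2 = y %/ 2)%N by lia.
    by [].
  - have -> : (y.+1 < 4 * nv)%N by lia.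
    have -> : (y.+1 %% 4 = 2)%N by lia.
    do !case: ifP => ? //=; try lia.
    have -> : ((y.+1 %/ 2).-1 = y %/ 2)%N by lia.
    by [].
  - have -> : (y.+1 < 4 * nv)%N by lia.
    have -> : (y.+1 %% 4 = 3)%N by lia.
    by do !case: ifP => ? //=.
case: ifP => // rR; have := wf rR; set r := (x %/ 6)%N.
rewrite /column_kind; case E: (the_rule r) => [a b cc up] /= [Ha Hb Hc].
have : (x %% 6 < 6)%N by lia.
case: z z6 => [|[|[|[|[|]]]]] // _; case: (x %% 6)%N => [|[|[|[|[|[|]]]]]] // _;
  repeat case: ifP => ? //=; rewrite /rule_input_a /rule_input_b ?E /=;
  try solve [by constructor 1|by constructor 2|by constructor 3]; unfold gate_y in *; lia.
Qed.

(** The last row of a cell is inert in every layer, so cells adjacent in y do not interact. *)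
Lemma compatible_y_wrap c j t x y z : y.+1 = depth ->
  compatible c j t (local_kind x y z) c (j + 1) t (local_kind x 0 z).
Proof.
move=> yd; suff -> : local_kind x y z = Inert by [].
rewrite /local_kind; unfold depth in yd; case: z => [|z].
  by rewrite /bus_kind; case: ifP => //; lia.
case: ifP => // rR; have := wf rR; set r := (x %/ 6)%N.
rewrite /column_kind; case E: (the_rule r) => [a b cc up] /= [Ha Hb Hc].
have : (x %% 6 < 6)%N by lia.
case: z => [|[|[|[|[|]]]]] //; case: (x %% 6)%N => [|[|[|[|[|[|]]]]]] // _;
  repeat case: ifP => ? //=; unfold gate_y in *; lia.
Qed.

Lemma bus_kind_even x p : (p < 2 * nv)%N -> (x + 4 <= width)%N ->
  bus_kind x (2 * p) = Wire p false.
Proof.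
move=> pv xw; rewrite /bus_kind; have -> : (2 * p < 4 * nv)%N by lia.
have -> : ((2 * p) %/ 2 = p)%N by lia.
have [->|->] : ((2 * p) %% 4 = 0 \/ (2 * p) %% 4 = 2)%N by lia.
- by case: ifP => //; lia.
- by rewrite xw.
Qed.

Lemma compatible_z c j t x y z : (z.+1 < 6)%N ->
  compatible c j t (local_kind x y z) c j t (local_kind x y z.+1).
Proof.
move=> z6; rewrite /local_kind /=; case rR: (x %/ 6 < size rules)%N; last first.
  exact: compatible_inert.
have := wf rR; set r := (x %/ 6)%N.
have xr : (x = 6 * r + x %% 6)%N by rewrite /r; lia.
rewrite /column_kind; case E: (the_rule r) => [a b cc up] /= [Ha Hb Hc].
have s6 : (x %% 6 < 6)%N by lia.
have xw : (x %% 6 <= 4 -> x + 4 <= width)%N by unfold width; lia.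
case: z z6 => [|[|[|[|[|]]]]] // _.
  case: (x %% 6)%N xw => [|[|[|[|[|[|s]]]]]] /= xw; try exact: compatible_inert.
  - case: eqP => [->|_]; last exact: compatible_inert.
    by rewrite bus_kind_even ?xw.
  - case: eqP => [->|_]; last exact: compatible_inert.
    by rewrite bus_kind_even ?xw //; case: up {E}.
  - case: eqP => [->|_]; last exact: compatible_inert.
    by rewrite bus_kind_even ?xw.
all: case: (x %% 6)%N s6 => [|[|[|[|[|[|]]]]]] /= // _;
  repeat case: ifP => ? //=; rewrite /rule_input_a /rule_input_b /rule_output ?E /=;
  try solve [by constructor 1|by constructor 2|by constructor 3]; unfold gate_y in *; try lia.
by destruct up; done || lia.
Qed.

(** Layer 5 contains only pins of rules with [up]; each meets the bus of its port in the next cell,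
    where the same fact is written without the flag. *)
Lemma compatible_z_wrap c j t x y :
  compatible c j t (local_kind x y 5) c j (t + 1) (local_kind x y 0).
Proof.
rewrite /local_kind; case rR: (x %/ 6 < size rules)%N => //.
have := wf rR; have xw : (x %% 6 <= 4 -> x + 4 <= width)%N by unfold width; lia.
rewrite /column_kind; case E: (the_rule _) => [a b cc up] /= [Ha Hb Hc].
case: (x %% 6)%N xw => [|[|[|s]]] //= xw.
case: eqP => //= ->; case: up E => //= E.
by rewrite bus_kind_even ?xw //= /port_fact /= addr0.
Qed.

Definition vertex_kind (v : vertex) : kind :=
  let: (x, y, z) := v in
  local_kind (local_coord width x) (local_coord depth y) (local_coord 6 z).

Definition vertex_compatible (v w : vertex) : Prop :=
  let: (x, y, z) := v in let: (x', y', z') := w in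
  compatible (x %/ width)%Z (y %/ depth)%Z (z %/ 6)%Z (vertex_kind v)
             (x' %/ width)%Z (y' %/ depth)%Z (z' %/ 6)%Z (vertex_kind w).

Hypothesis rules_gt0 : (0 < size rules)%N.

Lemma width_gt0 : (0 < width)%N. Proof. by rewrite /width addn2. Qed.
Lemma depth_gt0 : (0 < depth)%N. Proof. by rewrite /depth addn4. Qed.

Lemma vertex_compatible_sym v w : vertex_compatible v w -> vertex_compatible w v.
Proof.
case: v w => [[x y] z] [[x' y'] z']; rewrite /vertex_compatible /compatible.
by case: (vertex_kind _) => [|p u|r]; case: (vertex_kind _).
Qed.

Lemma vertex_compatible_neighbours v w : w \in neighbours v -> vertex_compatible v w.
Proof.
have hx x y z : vertex_compatible (x, y, z) (x + 1, y, z).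
  rewrite /vertex_compatible /vertex_kind; have z6 := local_coord_lt z (isT : 0 < 6)%N.
  case: (local_coord_succ x width_gt0) => [[H [-> ->]]|[H [-> ->]]].
    exact: compatible_x.
  exact: compatible_x_wrap.
have hy x y z : vertex_compatible (x, y, z) (x, y + 1, z).
  rewrite /vertex_compatible /vertex_kind; have z6 := local_coord_lt z (isT : 0 < 6)%N.
  case: (local_coord_succ y depth_gt0) => [[H [-> ->]]|[H [-> ->]]].
    exact: compatible_y.
  exact: compatible_y_wrap.
have hz x y z : vertex_compatible (x, y, z) (x, y, z + 1).
  rewrite /vertex_compatible /vertex_kind.
  case: (local_coord_succ z (isT : 0 < 6)%N) => [[H [-> ->]]|[H [-> ->]]].
    exact: compatible_z.
  case: H => ->; exact: compatible_z_wrap.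
case: v => [[x y] z]; rewrite !inE => /or4P [|||/or3P []] /eqP -> //;
  apply: vertex_compatible_sym.
- by have := hx (x - 1) y z; rewrite subrK.
- by have := hy x (y - 1) z; rewrite subrK.
- by have := hz x y (z - 1); rewrite subrK.
Qed.

Lemma local_kind_gate x y z r : local_kind x y z = Gate r ->
  [/\ x = (6 * r + 2)%N, y = gate_y, z = 2%N & (r < size rules)%N].
Proof.
rewrite /local_kind; case: z => [|z].
  by rewrite /bus_kind; do !case: ifP => // _; case: (y %% 4)%N => [|[|[|]]] //;
    do !case: ifP => // _.
case: ifP => // rR; have := wf rR.
rewrite /column_kind; case E: (the_rule _) => [a b cc up] /= [Ha Hb Hc].
case: z => [|[|[|[|[|]]]]] //; case s: (x %% 6)%N => [|[|[|[|[|[|]]]]]] //;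
  repeat case: ifP => ? //=.
case=> <-; split=> //; first lia.
exact/eqP.
Qed.

Definition place (c j t : int) (x y z : nat) : vertex :=
  (c * width + x%:Z, j * depth + y%:Z, t * 6 + z%:Z).

Lemma vertex_kind_place c j t x y z :
  (x < width)%N -> (y < depth)%N -> (z < 6)%N ->
  vertex_kind (place c j t x y z) = local_kind x y z.
Proof.
move=> xw yd z6; rewrite /vertex_kind /place.
by have [-> _] := local_coordE c xw; have [-> _] := local_coordE j yd;
  have [-> _] := @local_coordE 6 t _ z6.
Qed.

Lemma placeE v : exists c j t x y z,
  [/\ v = place c j t x y z, (x < width)%N, (y < depth)%N & (z < 6)%N].
Proof.
case: v => [[x y] z].
exists (x %/ width)%Z, (y %/ depth)%Z, (z %/ 6)%Z, (local_coord width x),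
  (local_coord depth y), (local_coord 6 z).
rewrite !local_coord_lt ?width_gt0 ?depth_gt0 //; split=> //.
have H n u : (0 < n)%N -> u = (u %/ n)%Z * n + (local_coord n u)%:Z.
  by move=> n0; rewrite {1}(divz_eq u n) /local_coord; lia.
by rewrite /place -!H ?width_gt0 ?depth_gt0.
Qed.

Lemma local_kind_gate_neighbours r : (r < size rules)%N ->
  [/\ local_kind (6 * r + 3) gate_y 2 = Wire (rule_b (the_rule r)) false,
      local_kind (6 * r + 1) gate_y 2 = Wire (rule_a (the_rule r)) false,
      local_kind (6 * r + 2) gate_y.+1 2 = Wire (rule_b (the_rule r)) false,
      local_kind (6 * r + 2) (4 * nv) 2 = Wire (rule_a (the_rule r)) false &
      local_kind (6 * r + 2) gate_y 3
        = Wire (rule_c (the_rule r)) (rule_up (the_rule r))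
      /\ local_kind (6 * r + 2) gate_y 1 = Inert].
Proof.
move=> rR; have := wf rR; rewrite /local_kind /column_kind.
have E k : (k < 6)%N -> ((6 * r + k) %/ 6 = r)%N by lia.
have E' k : (k < 6)%N -> ((6 * r + k) %% 6 = k)%N by lia.
rewrite !E // !E' // rR; case: (the_rule r) => a b cc up /= [Ha Hb Hc].
rewrite !eqxx !leqnn /gate_y; split=> //.
- by rewrite leqnSn.
- by rewrite leq_addr.
- by rewrite !ifF //; lia.
- by split=> //; rewrite ifF //; lia.
Qed.

(** The ROM, kept abstract: only the presence of gates may vary, and only with the x-coordinate of
    the cell. *)
Variable enabled : int -> nat -> bool.

Definition layout_height (v : vertex) : int :=
  match vertex_kind v with
  | Inert => -1
  | Wire _ _ => 5
  | Gate r => if enabled (v.1.1 %/ width)%Z r then 2 else -1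
  end.

Definition layout_config (v : vertex) : int :=
  layout_height v + (v == (0, 0, 0) : nat)%:Z.

Lemma vertex_kind_origin : (0 < nv)%N -> vertex_kind (0, 0, 0) = Wire 0 false.
Proof.
move=> nv0.
have := @vertex_kind_place 0 0 0 0 0 0 width_gt0 depth_gt0 isT.
rewrite /place !mul0r !addr0 => ->.
by rewrite /local_kind (@bus_kind_even _ 0) // /width; lia.
Qed.

(** * Upper bound: a model of the rules limits the topplings *)

Section Soundness.

Variable M : fact -> bool.
Hypothesis M_closed : forall c j t r, (r < size rules)%N -> enabled c r ->
  M (rule_input_a c j t r) -> M (rule_input_b c j t r) -> M (rule_output c j t r).

(** The candidate for the stabilising set. A gate follows its inputs and not its output, whose fact
    may hold because of another rule. *)
Definition truth (v : vertex) : bool :=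
  let: (x, y, z) := v in
  let c := (x %/ width)%Z in let j := (y %/ depth)%Z in let t := (z %/ 6)%Z in
  match vertex_kind v with
  | Inert => false
  | Wire p up => M (port_fact c j t p up)
  | Gate r => [&& enabled c r, M (rule_input_a c j t r) & M (rule_input_b c j t r)]
  end.

Arguments truth : simpl never.

Lemma truth_place c j t x y z : (x < width)%N -> (y < depth)%N -> (z < 6)%N ->
  truth (place c j t x y z) =
  match local_kind x y z with
  | Inert => false
  | Wire p up => M (port_fact c j t p up)
  | Gate r => [&& enabled c r, M (rule_input_a c j t r) & M (rule_input_b c j t r)]
  end.
Proof.
move=> xw yd z6; rewrite /truth -(vertex_kind_place c j t xw yd z6) /place.
by have [_ ->] := local_coordE c xw; have [_ ->] := local_coordE j yd;
  have [_ ->] := @local_coordE 6 t _ z6.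
Qed.

Lemma neighbours_place c j t x y z : neighbours (place c j t x.+1 y.+1 z.+1) =
  [:: place c j t x.+2 y.+1 z.+1; place c j t x y.+1 z.+1;
      place c j t x.+1 y.+2 z.+1; place c j t x.+1 y z.+1;
      place c j t x.+1 y.+1 z.+2; place c j t x.+1 y.+1 z].
Proof.
rewrite /neighbours /place.
have E1 (a : int) (n : nat) : a + n.+1%:Z - 1 = a + n%:Z by lia.
have E2 (a : int) (n : nat) : a + n.+1%:Z + 1 = a + n.+2%:Z by lia.
by rewrite !E1 !E2.
Qed.

Lemma count_gate_neighbours c j t r : (r < size rules)%N ->
  count truth (neighbours (place c j t (6 * r + 2) gate_y 2)) =
  (2 * M (rule_input_a c j t r) + 2 * M (rule_input_b c j t r) + M (rule_output c j t r))%N.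
Proof.
move=> rR; have [k1 k2 k3 k4 [k5 k6]] := local_kind_gate_neighbours rR.
have yd : (gate_y.+1 < depth)%N by rewrite /gate_y /depth; lia.
have xw : (6 * r + 3 < width)%N by rewrite /width; lia.
have -> : neighbours (place c j t (6 * r + 2) gate_y 2) =
    [:: place c j t (6 * r + 3) gate_y 2; place c j t (6 * r + 1) gate_y 2;
        place c j t (6 * r + 2) gate_y.+1 2; place c j t (6 * r + 2) (4 * nv) 2;
        place c j t (6 * r + 2) gate_y 3; place c j t (6 * r + 2) gate_y 1].
  have -> : gate_y = (4 * nv).+1 by rewrite /gate_y addn1.
  by rewrite addn3 addn2 addn1 neighbours_place.
rewrite /= !truth_place ?(ltnW yd) //; try by rewrite /depth /width; lia.
rewrite k1 k2 k3 k4 k5 k6.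
rewrite /rule_input_a /rule_input_b /rule_output.
by do 3!case: (M _).
Qed.

Lemma truth_inert v : vertex_kind v = Inert -> truth v = false.
Proof. by case: v => [[x y] z]; rewrite /truth => ->. Qed.

(* A false net sees no toppled neighbour: a true gate cannot read it, and a true
   gate cannot write to it. *)
Lemma truth_wire_neighbours v p up : vertex_kind v = Wire p up -> ~~ truth v ->
  forall w, w \in neighbours v -> ~~ truth w.
Proof.
move=> kv Tv w /vertex_compatible_neighbours; move: kv Tv.
case: v w => [[x y] z] [[x' y'] z']; rewrite /vertex_compatible /truth => -> Tv.
case kw: (vertex_kind _) => [|p' up'|r] //=; first by move=> <-.
have rR : (r < size rules)%N by have [] := local_kind_gate kw.
move=> Hor; apply/negP => /and3P [en Ma Mb]; case/negP: Tv.
by case: Hor => ->; last exact: M_closed.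
Qed.

Hypothesis nv_gt0 : (0 < nv)%N.
Hypothesis M_start : M (0%N, 0, 0, 0).

Lemma truth_closed v :
  layout_config v + (count truth (neighbours v))%:Z < 6 + 6 * (truth v : nat)%:Z.
Proof.
have c6 : (count truth (neighbours v) <= 6)%N.
  by rewrite (leq_trans (count_size _ _)) //; case: v => [[x y] z].
rewrite /layout_config; case: eqP => [->|_] /=.
  rewrite /layout_height vertex_kind_origin //.
  have -> : truth (0, 0, 0) by rewrite /truth vertex_kind_origin // !div0z; exact: M_start.
  (* The added chip brings the origin to 6, so at most five of its neighbours may topple; this one
     lies in the inert last row of the adjacent cell. *)
  suff H : truth (0, 0 - 1, 0) = false.
    by rewrite /neighbours /= H; do 5!case: (truth _).
  apply: truth_inert; rewrite /vertex_kind.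
  have -> : local_coord depth (0 - 1) = depth.-1.
    have d0 := depth_gt0.
    have [] := @local_coordE depth (-1) depth.-1; first by lia.
    by have -> : -1 * depth%:Z + (depth.-1)%:Z = 0 - 1 by lia.
  have : local_kind (local_coord width 0) depth.-1 (local_coord 6 0) = Inert.
    rewrite /local_coord !mod0z /= /local_kind /bus_kind ifF // /depth; lia.
  by [].
rewrite addr0 /layout_height; case kv: (vertex_kind v) => [|p up|r].
(* From height -1, six toppled neighbours lead only to 5. *)
- by rewrite truth_inert //; lia.
- have [Tv|Tv] := boolP (truth v); first by lia.
  rewrite (_ : count _ _ = 0%N) //; apply/eqP.
  by rewrite -leqn0 leqNgt -has_count; apply/hasPn; apply: truth_wire_neighbours kv Tv.
have [c [j [t [x [y [z [E xw yd z6]]]]]]] := placeE v; subst v.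
move: kv; rewrite vertex_kind_place // => kv.
have [Ex Ey Ez rR] := local_kind_gate kv; subst x y z.
have [_ ->] := local_coordE c xw; rewrite truth_place // kv.
have [en|_] := boolP (enabled c r); last by lia.
(* One input, touching twice, and the output bring height 2 only to 5. *)
rewrite count_gate_neighbours //; have := @M_closed c j t r rR en.
by case: (M _) (M _) (M _) => [] [] [] //= H; have := H isT isT.
Qed.

Definition int_range (n : nat) : seq int := [seq i%:Z - n%:Z | i <- iota 0 (2 * n).+1].

Lemma mem_int_range n (x : int) : - n%:Z <= x <= n%:Z -> x \in int_range n.
Proof.
move=> H; apply/mapP; exists (absz (x + n%:Z)); last by lia.
by rewrite mem_iota /= add0n ltnS; lia.
Qed.

Lemma layout_finite (b : nat) :
  (forall v c j t, M (v, c, j, t) ->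
     [/\ - b%:Z <= c <= b%:Z, - b%:Z <= j <= b%:Z & - b%:Z <= t <= b%:Z]) ->
  ~ infinitely_many_topplings layout_config.
Proof.
(* A vertex may sit one cell away from the cell of its fact, because of a left port or of [up]; the
   offset inside the cell costs one more: hence [b + 2]. *)
move=> Hb; pose box m := int_range ((b + 2) * m).
apply: (@finitely_many_topplings _ truth truth_closed
  [seq (u, z) | u <- [seq (x, y) | x <- box width, y <- box depth], z <- box 6%N]).
move=> v; have [c [j [t [x [y [z [-> xw yd z6]]]]]]] := placeE v.
rewrite truth_place // => Tv.
have [p [up Mf]] : exists p up, M (port_fact c j t p up).
  case: (local_kind x y z) Tv => [|p up|r] // Tv; first by exists p, up.
  case/and3P: Tv => _ Ma _; by exists (rule_a (the_rule r)), false.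
move: Mf; rewrite /port_fact => /Hb [Hc Hj Ht].
have p2 : (p %% 2 < 2)%N by lia.
have up1 : (up <= 1)%N by case: (up).
apply: (@allpairs_f _ _ vertex pair); last by apply: mem_int_range; nia.
by apply: (@allpairs_f _ _ (int * int)%type pair); apply: mem_int_range; nia.
Qed.
End Soundness.

(** * Lower bound: derivable facts topple *)

Inductive derivable : fact -> Prop :=
  | DerivableStart : derivable (0%N, 0, 0, 0)
  | DerivableRule c j t r : (r < size rules)%N -> enabled c r ->
      derivable (rule_input_a c j t r) -> derivable (rule_input_b c j t r) ->
      derivable (rule_output c j t r).

(** One vertex stands for a whole net: the left end of its bus. *)
Definition net_root (f : fact) : vertex :=
  let: (v, c, j, t) := f in place c j t 0 (4 * v) 0.

Notation toppled := (forced layout_config).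

Definition is_wire (k : kind) : bool := if k is Wire _ _ then true else false.

Lemma wire_toppled v w : toppled v -> w \in neighbours v ->
  is_wire (vertex_kind w) -> toppled w.
Proof.
move=> Fv vw; case kw: (vertex_kind w) => [|p up|r] // _.
apply: (@Forced _ w [:: v]) => //.
- by move=> u; rewrite inE => /eqP ->; rewrite neighbours_sym.
- by move=> u; rewrite inE => /eqP ->.
- by rewrite /layout_config /layout_height kw /=; lia.
Qed.

Lemma line_toppled (g : nat -> vertex) a b :
  (forall k, g k.+1 \in neighbours (g k)) ->
  (forall k, (minn a b <= k <= maxn a b)%N -> is_wire (vertex_kind (g k))) ->
  toppled (g a) -> toppled (g b).
Proof.
move=> gn gw; have [ab|ba] := leqP a b.
  rewrite (minn_idPl ab) (maxn_idPr ab) in gw.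
  rewrite -(subnKC ab) in gw *.
  elim: (b - a)%N gw => [|m IH] gw Fa; first by rewrite addn0.
  rewrite addnS; apply: (wire_toppled _ (gn _)); last by apply: gw; lia.
  by apply: IH => // k Hk; apply: gw; lia.
rewrite (minn_idPr (ltnW ba)) (maxn_idPl (ltnW ba)) in gw.
rewrite -(subnKC (ltnW ba)) in gw *.
elim: (a - b)%N gw => [|m IH] gw; first by rewrite addn0.
rewrite addnS => Fa; apply: IH => [k Hk|]; first by apply: gw; lia.
apply: (wire_toppled Fa); first by rewrite neighbours_sym gn.
by apply: gw; lia.
Qed.

Lemma place_x c j t y z k : place c j t k.+1 y z \in neighbours (place c j t k y z).
Proof. by rewrite !inE /place !xpair_eqE; lia. Qed.
Lemma place_y c j t x z k : place c j t x k.+1 z \in neighbours (place c j t x k z).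
Proof. by rewrite !inE /place !xpair_eqE; lia. Qed.
Lemma place_z c j t x y k : place c j t x y k.+1 \in neighbours (place c j t x y k).
Proof. by rewrite !inE /place !xpair_eqE; lia. Qed.

Lemma place_x_wrap c j t x y z : place c j t (width + x) y z = place (c + 1) j t x y z.
Proof. by rewrite /place; congr (_, _, _); lia. Qed.
Lemma place_z_wrap c j t x y : place c j t x y 6 = place c j (t + 1) x y 0.
Proof. by rewrite /place; congr (_, _, _); lia. Qed.

(** Since wires are two-way, this serves both to fetch an input from its bus and to deliver an
    output to it. An odd port is reached from the cell to the left through the jog. *)
Lemma bus_toppled c j t p x : (p < 2 * nv)%N -> (x + 4 <= width)%N ->
  (toppled (net_root (port_fact c j t p false)) <-> toppled (place c j t x (2 * p) 0)).
Proof.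
move=> pv xw; rewrite /net_root /port_fact addr0.
have dW : forall y, (y < 4 * nv)%N -> (y < depth)%N by rewrite /depth; lia.
have [p0|p1] : (p %% 2 = 0 \/ p %% 2 = 1)%N by lia.
  have -> : (4 * (p %/ 2) = 2 * p)%N by lia.
  rewrite p0 subr0.
  split; apply: (@line_toppled (fun k => place c j t k (2 * p) 0)) => k;
    rewrite ?place_x // => Hk; rewrite vertex_kind_place ?dW //; try lia;
    by rewrite /local_kind bus_kind_even //; lia.
have -> : (2 * p = 4 * (p %/ 2) + 2)%N by lia.
rewrite p1; set v := (p %/ 2)%N; have vn : (v < nv)%N by rewrite /v; lia.
(* All places are written in coordinates of the left cell [c'], continued past its border; [e] is
   the column of the jog. *)
set c' := c - 1; have -> : c = c' + 1 by rewrite /c' subrK.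
rewrite -place_x_wrap; pose e := (width - 2)%N.
have w8 : (8 <= width)%N by rewrite /width; lia.
have y0 : forall k, (k < 3)%N -> ((4 * v + k) %% 4 = k)%N by lia.
have H1 k : (k <= e)%N -> is_wire (vertex_kind (place c' j t k (4 * v) 0)).
  move=> ke; rewrite vertex_kind_place ?dW //; try lia.
  by rewrite /local_kind /bus_kind -[(4 * v)%N]addn0 y0 // !ifT //; lia.
have H2 k : (4 * v <= k <= 4 * v + 2)%N -> is_wire (vertex_kind (place c' j t e k 0)).
  move=> ke; rewrite vertex_kind_place ?dW //; try lia.
  rewrite /local_kind /bus_kind ifT; last by lia.
  have [->|[->|->]] : (k = 4 * v + 0 \/ k = 4 * v + 1 \/ k = 4 * v + 2)%N by lia.
  - by rewrite y0 //; do !case: ifP => ? //; lia.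
  - by rewrite y0 //; do !case: ifP => ? //; lia.
  - by rewrite y0 //; do !case: ifP => ? //; lia.
have H3 k : (e <= k <= width + x)%N -> is_wire (vertex_kind (place c' j t k (4 * v + 2) 0)).
  move=> /andP [ke kx]; have [kw|kw] := ltnP k width.
    rewrite vertex_kind_place ?dW //; try lia.
    by rewrite /local_kind /bus_kind y0 //; do !case: ifP => ? //; lia.
  rewrite -(subnKC kw) place_x_wrap vertex_kind_place ?dW //; try lia.
  by rewrite /local_kind /bus_kind y0 //; do !case: ifP => ? //; lia.
split=> F.
  apply: (@line_toppled (fun k => place c' j t k (4 * v + 2) 0) e) => [k|k Hk|];
    [exact: place_x|by apply: H3; lia|].
  apply: (@line_toppled (fun k => place c' j t e k 0) (4 * v)) => [k|k Hk|];
    [exact: place_y|by apply: H2; lia|].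
  apply: (@line_toppled (fun k => place c' j t k (4 * v) 0) 0) => [k|k Hk|//];
    [exact: place_x|by apply: H1; lia].
apply: (@line_toppled (fun k => place c' j t k (4 * v) 0) e) => [k|k Hk|];
  [exact: place_x|by apply: H1; lia|].
apply: (@line_toppled (fun k => place c' j t e k 0) (4 * v + 2)) => [k|k Hk|];
  [exact: place_y|by apply: H2; lia|].
apply: (@line_toppled (fun k => place c' j t k (4 * v + 2) 0) (width + x)) => [k|k Hk|//];
  [exact: place_x|by apply: H3; lia].
Qed.

Lemma column_wire c j t r s y z : (r < size rules)%N -> (s < 6)%N -> (y < depth)%N ->
  (z < 5)%N -> is_wire (column_kind r s y z.+1) ->
  is_wire (vertex_kind (place c j t (6 * r + s) y z.+1)).
Proof.
move=> rR s6 yd z6 H; rewrite vertex_kind_place //; last by rewrite /width; lia.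
rewrite /local_kind; have -> : ((6 * r + s) %/ 6 = r)%N by lia.
by rewrite rR; have -> : ((6 * r + s) %% 6 = s)%N by lia.
Qed.

Lemma rule_input_a_toppled c j t r
  : (r < size rules)%N -> toppled (net_root (rule_input_a c j t r)) ->
  toppled (place c j t (6 * r + 1) gate_y 2) /\
  toppled (place c j t (6 * r + 2) (4 * nv) 2).
Proof.
move=> rR; have := wf rR; rewrite /rule_input_a.
have W s y z := @column_wire c j t r s y z rR.
case E: (the_rule r) => [a b cc up] /= [Ha _ _].
have xw : (6 * r + 0 + 4 <= width)%N by rewrite /width; lia.
move/(bus_toppled _ _ _ Ha xw) => F0.
rewrite /column_kind E /depth /gate_y in W.
have Fr y : (2 * a <= y <= gate_y)%N -> toppled (place c j t (6 * r + 0) y 2).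
  move=> Hy; apply: (@line_toppled (fun k => place c j t (6 * r + 0) k 2) (2 * a)) => [k|k Hk|];
    [exact: place_y| |].
    by apply: W => //; rewrite /gate_y in Hy; rewrite ?ifT //; lia.
  apply: (wire_toppled _ (place_z _ _ _ _ _ _)); last by apply: W => //=;
    do ?case: ifP => //; lia.
  apply: (wire_toppled _ (place_z _ _ _ _ _ _)); last by apply: W => //=;
    do ?case: ifP => //; lia.
  exact: F0.
have F1 y : (4 * nv <= y <= gate_y)%N -> toppled (place c j t (6 * r + 1) y 2).
  move=> Hy; apply: (@wire_toppled (place c j t (6 * r + 0) y 2)).
  - by apply: Fr; lia.
  - by rewrite addn0 addn1 place_x.
  - by rewrite /gate_y in Hy; apply: W => //=; do ?case: ifP => //; lia.
split; first by apply: F1; rewrite /gate_y; lia.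
apply: (@wire_toppled (place c j t (6 * r + 1) (4 * nv) 2)).
- by apply: F1; rewrite /gate_y; lia.
- by rewrite addn2 addn1 place_x.
- by apply: W => //=; do ?case: ifP => //; lia.
Qed.

Lemma rule_input_b_toppled c j t r
  : (r < size rules)%N -> toppled (net_root (rule_input_b c j t r)) ->
  toppled (place c j t (6 * r + 3) gate_y 2) /\
  toppled (place c j t (6 * r + 2) gate_y.+1 2).
Proof.
move=> rR; have := wf rR; rewrite /rule_input_b.
have W s y z := @column_wire c j t r s y z rR.
case E: (the_rule r) => [a b cc up] /= [_ Hb _].
have xw : (6 * r + 4 + 4 <= width)%N by rewrite /width; lia.
move/(bus_toppled _ _ _ Hb xw) => F0.
rewrite /column_kind E /depth /gate_y in W.
have Fr y : (2 * b <= y <= gate_y)%N -> toppled (place c j t (6 * r + 4) y 2).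
  move=> Hy; apply: (@line_toppled (fun k => place c j t (6 * r + 4) k 2) (2 * b)) => [k|k Hk|];
    [exact: place_y| |].
    by apply: W => //; rewrite /gate_y in Hy; rewrite ?ifT //; lia.
  apply: (wire_toppled _ (place_z _ _ _ _ _ _)); last by apply: W => //=;
    do ?case: ifP => //; lia.
  apply: (wire_toppled _ (place_z _ _ _ _ _ _)); last by apply: W => //=;
    do ?case: ifP => //; lia.
  exact: F0.
have F3 : toppled (place c j t (6 * r + 3) gate_y 2).
  apply: (@wire_toppled (place c j t (6 * r + 4) gate_y 2)).
  - by apply: Fr; rewrite /gate_y; lia.
  - by rewrite neighbours_sym addnS place_x.
  - by rewrite /gate_y; apply: W => //=; do ?case: ifP => //; lia.
split=> //.
apply: (@wire_toppled (place c j t (6 * r + 3) gate_y.+1 2)).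
- apply: (wire_toppled F3 (place_y _ _ _ _ _ _)).
  by rewrite /gate_y; apply: W => //=; do ?case: ifP => //; lia.
- by rewrite neighbours_sym addnS place_x.
- by rewrite /gate_y; apply: W => //=; do ?case: ifP => //; lia.
Qed.

(** Two neighbours on each input supply the four chips missing at height 2. *)
Lemma gate_toppled c j t r : (r < size rules)%N -> enabled c r ->
  toppled (net_root (rule_input_a c j t r)) -> toppled (net_root (rule_input_b c j t r)) ->
  toppled (place c j t (6 * r + 2) gate_y 2).
Proof.
move=> rR en /(rule_input_a_toppled rR) [Fa1 Fa2] /(rule_input_b_toppled rR) [Fb1 Fb2].
have yd : (gate_y < depth)%N by rewrite /gate_y /depth; lia.
have xw : (6 * r + 2 < width)%N by rewrite /width; lia.
apply: (@Forced _ _ [:: place c j t (6 * r + 1) gate_y 2; place c j t (6 * r + 2) (4 * nv) 2;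
  place c j t (6 * r + 3) gate_y 2; place c j t (6 * r + 2) gate_y.+1 2]).
- by rewrite /= !inE /place !xpair_eqE /gate_y; lia.
- have -> : gate_y = (4 * nv).+1 by rewrite /gate_y addn1.
  rewrite addn3 addn2 addn1 neighbours_place => u; rewrite !inE.
  by move=> /or4P [] ->; rewrite ?orbT.
- by move=> u; rewrite !inE => /or4P [] /eqP ->.
- rewrite /layout_config /layout_height vertex_kind_place // /local_kind.
  have -> : ((6 * r + 2) %/ 6 = r)%N by lia.
  have -> : ((6 * r + 2) %% 6 = 2)%N by lia.
  rewrite rR /column_kind; case: (the_rule r) => a b cc up.
  rewrite eqxx ifF; last by rewrite /gate_y; lia.
  have [_] := local_coordE c xw; rewrite /place /= => ->.
  by rewrite en; lia.
Qed.

Lemma rule_output_toppled c j t r : (r < size rules)%N ->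
  toppled (place c j t (6 * r + 2) gate_y 2) -> toppled (net_root (rule_output c j t r)).
Proof.
move=> rR Fg; have := wf rR; rewrite /rule_output.
have W s y z := @column_wire c j t r s y z rR.
case E: (the_rule r) => [a b cc up] /= [_ _ Hc].
have xw : (6 * r + 2 + 4 <= width)%N by rewrite /width; lia.
rewrite /column_kind E /depth /gate_y in W.
have F4 : toppled (place c j t (6 * r + 2) (2 * cc) 4).
  apply: (@line_toppled (fun k => place c j t (6 * r + 2) k 4) gate_y) => [k|k Hk|];
    [exact: place_y| |].
    by rewrite /gate_y in Hk; apply: W => //=; do ?case: ifP => //; lia.
  do 2 (apply: (wire_toppled _ (place_z _ _ _ _ _ _));
    last by rewrite /gate_y; apply: W => //=; do ?case: ifP => //; lia).
  exact: Fg.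
have pf d : port_fact c j t cc d = port_fact c j (t + (d : nat)%:Z) cc false.
  by rewrite /port_fact addr0.
suff: toppled (net_root (port_fact c j t cc up)) by [].
rewrite pf; apply/(bus_toppled _ _ _ Hc xw); case: up E W => E W.
  rewrite -place_z_wrap; apply: (@wire_toppled (place c j t (6 * r + 2) (2 * cc) 5)).
  - apply: (wire_toppled F4 (place_z _ _ _ _ _ _)).
    by apply: W => //=; do ?case: ifP => //; lia.
  - exact: place_z.
  - rewrite place_z_wrap vertex_kind_place //; rewrite /depth; try lia.
    by rewrite /local_kind bus_kind_even //; lia.
rewrite addr0; have dn z : toppled (place c j t (6 * r + 2) (2 * cc) z.+1) ->
    is_wire (vertex_kind (place c j t (6 * r + 2) (2 * cc) z)) ->
    toppled (place c j t (6 * r + 2) (2 * cc) z).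
  by move=> H; apply: (wire_toppled H); rewrite neighbours_sym place_z.
apply: (dn _); first apply: (dn _); first apply: (dn _); first apply: (dn _ F4).
- by apply: W => //=; do ?case: ifP => //; lia.
- by apply: W => //=; do ?case: ifP => //; lia.
- by apply: W => //=; do ?case: ifP => //; lia.
- rewrite vertex_kind_place //; rewrite /depth; try lia.
  by rewrite /local_kind bus_kind_even //; lia.
Qed.

Hypothesis nv_gt0 : (0 < nv)%N.

Lemma derivable_toppled f : derivable f -> toppled (net_root f).
Proof.
elim=> {f} [|c j t r rR en _ IHa _ IHb]; last first.
  exact: rule_output_toppled (gate_toppled rR en IHa IHb).
(* At the origin the added chip alone reaches the threshold. *)
apply: (@Forced _ _ [::]) => //; rewrite /net_root /place !mul0r !addr0.
by rewrite /layout_config /layout_height vertex_kind_origin //.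
Qed.

(** That no vertex topples twice comes from the model in which every fact holds, which is closed
    under any rules. Ever later facts lie at ever greater z and give as many forced vertices as
    desired. *)
Lemma layout_infinite :
  (forall n : nat, exists v c j, derivable (v, c, j, n%:Z)) ->
  infinitely_many_topplings layout_config.
Proof.
move=> H; apply: (@infinitely_many_of_forced _ (truth xpredT)).
  exact: truth_closed.
elim=> [|k [l [Ul szl Fl]]]; first by exists [::].
pose z (v : vertex) := absz v.2; set m := (\max_(u <- l) z u)%N.
have [v [c [j /derivable_toppled]]] := H m.+1.
set w := net_root _ => Fw; exists (w :: l); split; rewrite /= ?szl ?Ul //.
  rewrite andbT; apply/negP => wl.
  have : (z w <= m)%N by apply: leq_bigmax_seq.
  by rewrite /z /w /net_root /place /=; lia.
by move=> u; rewrite inE => /orP [/eqP ->|/Fl].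
Qed.
End Layout.

(** * A Horn program running a Turing machine *)

Definition rank (T : finType) (x : T) : nat := enum_rank x.
Arguments rank : simpl never.

Lemma rank_lt (T : finType) (x : T) : (rank x < #|T|)%N.
Proof. exact: ltn_ord. Qed.

Lemma rank_inj (T : finType) : injective (@rank T).
Proof. by move=> x y /val_inj /enum_rank_inj. Qed.

Section Program.

Variables (na : nat) (e : 'I_na) (M : turing_machine 'I_na).

Notation Q := (tm_state M).
Notation S := (tm_symbol M).
Notation blank := (tm_embed M None).

(* Row [0] reads the ROM, row [k + 1] contains the [k]-th configuration of [M].
   [RCopy] and [LCopy] are the waves that copy the tape; [RExt] and [LExt] move the
   end markers [RMark] and [LMark] outwards by one cell. *)
Inductive var : Type :=
  | Start | Init | RCopy | LCopy | RExt | LExt | RMark | LMark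
  | Letter of 'I_na | Sym of S | Head of Q.

(** [Start] has index 0 because the added chip lies on the first bus of its cell. *)
Definition var_index (v : var) : nat :=
  match v with
  | Start => 0 | Init => 1 | RCopy => 2 | LCopy => 3
  | RExt => 4 | LExt => 5 | RMark => 6 | LMark => 7
  | Letter a => 8 + a
  | Sym s => 8 + na + rank s
  | Head q => 8 + na + #|S| + rank q
  end.

Definition num_vars : nat := (8 + na + #|S| + #|Q|)%N.

Lemma var_index_lt v : (var_index v < num_vars)%N.
Proof.
case: v => [||||||||a|s|q]; rewrite /num_vars /var_index; try lia.
- by have := ltn_ord a; lia.
- by have := rank_lt s; lia.
- by have := rank_lt q; lia.
Qed.

Lemma var_index_inj : injective var_index.
Proof.
have Ha (a : 'I_na) := ltn_ord a.
have Hs (s : S) := rank_lt s.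
move=> v v'; case: v => [||||||||a|s|q]; case: v' => [||||||||a'|s'|q'] //;
  rewrite /var_index; try lia;
  move=> E; try (have := Ha a; lia); try (have := Ha a'; lia);
  try (have := Hs s; lia); try (have := Hs s'; lia); f_equal.
- by apply: val_inj => /=; lia.
- by apply: rank_inj; lia.
- by apply: rank_inj; lia.
Qed.

(* [(v, true)] is the variable [v] of the cell to the left. *)
Definition port (p : var * bool) : nat := (2 * var_index p.1 + p.2)%N.

Definition clause (a b c : var * bool) (up : bool) : nat * nat * nat * bool :=
  (port a, port b, port c, up).

Notation here v := (v, false).
Notation left v := (v, true).

(** They come first in the program, so that rule number [a] is the ROM gate of letter [a]; the
    numbering of the holes relies on this. *)
Definition rom_clauses :=
  [seq clause (left Init) (left Init) (here (Letter a)) false | a <- enum 'I_na].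

(** Halting states get no clause, so no wave leaves them. A rule sees its own cell and the one to
    the left, so a step to the right is stated from the cell that the head enters. *)
Definition head_clauses (q : Q) (s : S) :=
  if (q == tm_accept M) || (q == tm_reject M) then [::] else
  let: (q', s', d) := tm_delta q s in
  [:: clause (here (Head q)) (here (Sym s)) (here (Sym s')) true;
      clause (here (Head q)) (here (Sym s)) (here RCopy) false;
      clause (here (Head q)) (here (Sym s)) (here LCopy) false;
      match d with
      | MoveLeft => clause (here (Head q)) (here (Sym s)) (left (Head q')) true
      | MoveRight => clause (left (Head q)) (left (Sym s)) (here (Head q')) true
      | Stay => clause (here (Head q)) (here (Sym s)) (here (Head q')) true
      end].

(** [Init] in a cell requests the letter of the next one; it starts in cell -1. Every letter but [e]
    passes it on, while [e] emits [RExt], which creates the first right marker; otherwise reading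
    would go on through the next period of the ROM. *)
Definition other_clauses :=
  [:: clause (here Start) (here Start) (here (Head (tm_start M))) true;
      clause (here Start) (here Start) (left LMark) true;
      clause (here Start) (here Start) (left Init) false;
      clause (left RExt) (left RExt) (here RMark) true;
      clause (here LExt) (here LExt) (left LMark) true;
      clause (left RCopy) (here RMark) (here (Sym blank)) true;
      clause (left RCopy) (here RMark) (here RExt) false;
      clause (here LCopy) (left LMark) (left (Sym blank)) true;
      clause (here LCopy) (left LMark) (left LExt) false;
      clause (here (Letter e)) (here (Letter e)) (here RExt) false]
  ++ [seq clause (here (Letter a)) (here (Letter a))
            (here (Sym (tm_embed M (Some a)))) true | a <- enum 'I_na]
  ++ [seq clause (here (Letter a)) (here (Letter a)) (here Init) false
     | a <- [seq a <- enum 'I_na | a != e]]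
  ++ [seq clause (left RCopy) (here (Sym s)) (here (Sym s)) true | s <- enum S]
  ++ [seq clause (left RCopy) (here (Sym s)) (here RCopy) false | s <- enum S]
  ++ [seq clause (here LCopy) (left (Sym s)) (left (Sym s)) true | s <- enum S]
  ++ [seq clause (here LCopy) (left (Sym s)) (left LCopy) false | s <- enum S]
  ++ flatten [seq flatten [seq head_clauses q s | s <- enum S] | q <- enum Q].

Definition clauses := rom_clauses ++ other_clauses.

Definition program : seq rule :=
  [seq Rule x.1.1.1 x.1.1.2 x.1.2 x.2 | x <- clauses].

Lemma size_rom_clauses : size rom_clauses = na.
Proof. by rewrite size_map size_enum_ord. Qed.

Lemma size_program : size program = (na + size other_clauses)%N.
Proof. by rewrite size_map size_cat size_rom_clauses. Qed.

Lemma program_gt0 : (0 < size program)%N.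
Proof. by rewrite size_program /other_clauses size_cat /=; lia. Qed.

Lemma port_lt p : (port p < 2 * num_vars)%N.
Proof. by rewrite /port; have := var_index_lt p.1; case: p.2; lia. Qed.

Lemma clause_ind (P : nat * nat * nat * bool -> Prop) :
  (forall a b c up, P (clause a b c up)) -> forall x, x \in clauses -> P x.
Proof.
move=> H x; rewrite !mem_cat !inE => /or4P [| | |]; last move=> /or3P [| |/or4P [| | |]].
- by case/mapP => a _ ->.
- by do 9?[case/orP => [/eqP -> //|]]; move/eqP => ->.
all: try by case/mapP => a _ ->.
case/flatten_mapP => q _ /flatten_mapP [s _]; rewrite /head_clauses.
case: ifP => // _; case: (tm_delta q s) => [[q' s'] d].
by rewrite !inE => /or4P [] /eqP -> //; case: d.
Qed.

Lemma the_rule_program r : (r < size program)%N -> exists x,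
  [/\ x \in clauses, x = nth (0, 0, 0, false)%N clauses r
    & the_rule program r = Rule x.1.1.1 x.1.1.2 x.1.2 x.2].
Proof.
move=> rR; exists (nth (0, 0, 0, false)%N clauses r).
by rewrite size_map in rR; rewrite mem_nth // /the_rule (nth_map (0, 0, 0, false)%N).
Qed.

Lemma program_well_formed : well_formed num_vars program.
Proof.
move=> r /the_rule_program [x [xc _ ->]] /=.
by elim/clause_ind: x / xc => a b c up; rewrite !port_lt.
Qed.

Lemma port_factE c j t v d up :
  port_fact c j t (port (v, d)) up = (var_index v, c - (d : nat)%:Z, j, t + (up : nat)%:Z).
Proof.
rewrite /port_fact /port /=.
have -> : ((2 * var_index v + d) %/ 2 = var_index v)%N by case: d; lia.
by have -> : ((2 * var_index v + d) %% 2 = d)%N by case: d; lia.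
Qed.


Variable u : seq 'I_na.

Notation w := (rcons u e).
Notation n := (size (rcons u e)).

Definition rom_letter (word : seq 'I_na) (c : int) : 'I_na :=
  nth e word (local_coord (size word) c).

Definition rom_enabled (word : seq 'I_na) (c : int) (r : nat) : bool :=
  (r < na)%N ==> (rom_letter word c == r :> nat).

Notation program_config := (layout_config num_vars program (rom_enabled w)).

Definition run (k : nat) : tm_config M := iter k (@tm_step _ M) (tm_init M w).

Notation tape k := (cfg_tape (run k)).
Notation head k := (cfg_head (run k)).

Lemma rom_size_gt0 : (0 < n)%N. Proof. by rewrite size_rcons. Qed.

Lemma rom_letterE (x : nat) : (x < n)%N -> rom_letter w x%:Z = nth e w x.
Proof.
move=> xn; have Hx : 0 <= x%:Z < n%:Z by lia.
by rewrite /rom_letter /local_coord (modz_small Hx).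
Qed.

Hypothesis e_notin_u : e \notin u.

Lemma nth_last_letter (x : nat) : (x < n)%N -> (nth e w x == e) = (x.+1 == n).
Proof.
rewrite size_rcons ltnS eqSS nth_rcons => xn; case: (ltnP x (size u)) => ux.
  rewrite (ltn_eqF ux); apply/negbTE.
  by apply: contra e_notin_u => /eqP <-; apply: mem_nth.
have -> : x = size u by lia.
by rewrite !eqxx.
Qed.

Lemma run_step k : ~~ tm_halted (run k) ->
  let: (q, s, d) := tm_delta (cfg_state (run k)) (tape k (head k)) in
  [/\ cfg_state (run k.+1) = q, head k.+1 = shift d (head k)
    & forall x, tape k.+1 x = if x == head k then s else tape k x].
Proof.
move=> Hk; rewrite /run iterS -/(run k) /tm_step (negbTE Hk).
by case: (tm_delta _ _) => [[q s] d].
Qed.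

Lemma head_bound k : - k%:Z <= head k <= k%:Z.
Proof.
elim: k => [//|k IH]; have [Hk|Hk] := boolP (tm_halted (run k)).
  by rewrite /run iterS -/(run k) /tm_step Hk; lia.
by have := run_step Hk; case: (tm_delta _ _) => [[q s] []] [_ -> _] /=; lia.
Qed.

(** Justifies the blanks appended at the end markers, which advance one cell per step, as fast as
    the head can. *)
Lemma tape_blank k x : n%:Z <= x /\ k%:Z <= x \/ x < 0 /\ x <= - k%:Z -> tape k x = blank.
Proof.
elim: k x => [|k IH] x Hx.
  rewrite /run /=; case: x Hx => x Hx //; rewrite onth_default //; lia.
have [Hk|Hk] := boolP (tm_halted (run k)).
  by rewrite /run iterS -/(run k) /tm_step Hk; apply: IH; lia.
have := run_step Hk; case: (tm_delta _ _) => [[q s] d] [_ _ ->].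
by have Hh := head_bound k; case: eqP => [xh|_]; [lia|apply: IH; lia].
Qed.

(** * A bounded model for a halting run *)

Section Halting.

Variable K : nat.
Hypothesis K_halted : tm_halted (run K).
Hypothesis K_first : forall k, (k < K)%N -> ~~ tm_halted (run k).

(** Row [t] describes configuration [t - 1]. Row [K + 1] still has tape, head and markers but no
    waves, so it starts no further row. *)
Definition spacetime (v : var) (x : int) (t : int) : bool :=
  let k := absz (t - 1) in
  match v with
  | Start => (t == 0) && (x == 0)
  | Init => (t == 0) && (- 1 <= x < n%:Z - 1)
  | Letter a => [&& t == 0, 0 <= x < n%:Z & nth e w (absz x) == a]
  | Sym s => [&& 1 <= t <= K%:Z + 1, - t < x < n%:Z + t - 1 & tape k x == s]
  | Head q => [&& 1 <= t <= K%:Z + 1, x == head k & cfg_state (run k) == q]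
  | RCopy => (1 <= t <= K%:Z) && (head k <= x < n%:Z + t - 1)
  | LCopy => (1 <= t <= K%:Z) && (- t < x <= head k)
  | RExt => (0 <= t <= K%:Z) && (x == n%:Z - 1 + t)
  | LExt => (1 <= t <= K%:Z) && (x == - t)
  | RMark => (1 <= t <= K%:Z + 1) && (x == n%:Z + t - 1)
  | LMark => (1 <= t <= K%:Z + 1) && (x == - t)
  end.

Definition true_fact (f : fact) : bool :=
  let: (i, x, j, t) := f in
  (j == 0) && if excluded_middle_informative (exists2 v, var_index v = i & spacetime v x t)
              then true else false.

Lemma true_factE v x j t : true_fact (var_index v, x, j, t) = (j == 0) && spacetime v x t.
Proof.
rewrite /true_fact; case: eqP => //= _.
case: excluded_middle_informative => [[v' E H]|H] /=.
  by rewrite (var_index_inj E) in H; rewrite H.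
by apply/esym/negbTE/negP => Hv; apply: H; exists v.
Qed.

Arguments true_fact : simpl never.
Arguments port_fact : simpl never.
Arguments port : simpl never.

Definition clause_true (x : nat * nat * nat * bool) :=
  forall c j t, true_fact (port_fact c j t x.1.1.1 false) ->
    true_fact (port_fact c j t x.1.1.2 false) -> true_fact (port_fact c j t x.1.2 x.2).

Lemma clause_trueP (a b c : var * bool) (up : bool) :
  (forall x t, spacetime a.1 (if a.2 then x - 1 else x) t ->
     spacetime b.1 (if b.2 then x - 1 else x) t ->
     spacetime c.1 (if c.2 then x - 1 else x) (if up then t + 1 else t)) ->
  clause_true (clause a b c up).
Proof.
case: a b c => [a da] [b db] [c dc] H x j t; rewrite /= !port_factE !true_factE addr0.
have E (d : bool) : x - (d : nat)%:Z = if d then x - 1 else x by case: d => //; lia.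
have -> : t + (up : nat)%:Z = if up then t + 1 else t by case: (up) => //; lia.
by rewrite !E; case: eqP => //= _ /H {}H /H.
Qed.

Lemma spacetime_init (a : 'I_na) x : rom_enabled w x a -> spacetime Init (x - 1) 0 ->
  spacetime (Letter a) x 0.
Proof.
rewrite /rom_enabled ltn_ord /= => Ha Hx; have [y xy] : exists y : nat, x = y%:Z.
  by exists (absz x); lia.
rewrite xy in Ha Hx *; move: Ha; rewrite rom_letterE; last by lia.
by move/eqP/val_inj => ->; rewrite eqxx andbT; lia.
Qed.

Lemma running (t : int) : 1 <= t <= K%:Z -> ~~ tm_halted (run (absz (t - 1))).
Proof. by move=> H; apply: K_first; lia. Qed.

Lemma head_clauses_true q s x : x \in head_clauses q s -> clause_true x.
Proof.
rewrite /head_clauses; case: ifP => // Hq.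
case D: (tm_delta q s) => [[q' s'] d].
have main y t : spacetime (Head q) y t -> spacetime (Sym s) y t ->
  [/\ 1 <= t <= K%:Z, y = head (absz (t - 1)), - t < y < n%:Z + t - 1 &
   let k := absz t in [/\ cfg_state (run k) = q', head k = shift d y
    & tape k y = s']].
  rewrite /=; case/and3P => t1 /eqP Ey /eqP Eq; case/and3P => _ ylt /eqP Es.
  (* In row [K + 1] the state is halting, contrary to the choice of [q]. *)
  have tK : t <= K%:Z.
    rewrite leNgt; apply/negP => tK; have E : absz (t - 1) = K by lia.
    by move: K_halted; rewrite /tm_halted -E Eq Hq.
  have tK' : 1 <= t <= K%:Z by lia.
  have := run_step (running tK'); rewrite Eq -Ey Es D.
  have -> : (absz (t - 1)).+1 = absz t by lia.
  by case=> -> -> ->; rewrite eqxx; split.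
have t1 (t : int) : absz (t + 1 - 1)%R = absz t by rewrite addrK.
rewrite !inE => /or4P [] /eqP ->.
- apply: clause_trueP => y t /=; move=> H1 /(main _ _ H1) [tK Ey ylt [Eq Eh Es]].
  by rewrite t1 Es eqxx andbT; lia.
- apply: clause_trueP => y t /=; move=> H1 /(main _ _ H1) [tK Ey ylt _].
  by lia.
- apply: clause_trueP => y t /=; move=> H1 /(main _ _ H1) [tK Ey ylt _].
  by lia.
case: d D main => D main; apply: clause_trueP => y t /=; move=>
  H1 /(main _ _ H1) [tK Ey ylt [Eq Eh Es]]; rewrite t1 Eq eqxx andbT Eh /=; lia.
Qed.

Lemma other_clauses_true x : x \in other_clauses -> clause_true x.
Proof.
have t1 (t : int) : absz (t + 1 - 1)%R = absz t by rewrite addrK.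
have n0 := rom_size_gt0.
rewrite !mem_cat => /or4P [| | |]; last move=> /or4P [| | |/orP []].
- rewrite !inE; do 9?[case/orP]; move=> /eqP ->; apply: clause_trueP => y t; rewrite /= ?t1.
  + by move=> /andP [/eqP -> /eqP ->] _; rewrite !eqxx; lia.
  + lia.
  + lia.
  + lia.
  + lia.
  + by move=> H1 H2; rewrite tape_blank ?eqxx; lia.
  + lia.
  + by move=> H1 H2; rewrite tape_blank ?eqxx; lia.
  + lia.
  + case/and3P => /eqP -> y0 He _; have := @nth_last_letter (absz y).
    by rewrite He; lia.
- case/mapP => a _ ->; apply: clause_trueP => y t; rewrite /= t1.
  case/and3P => /eqP -> y0 /eqP Ha _; rewrite /run /=.
  case: y y0 Ha => y y0 Ha //; rewrite onthE (nth_map e) ?Ha ?eqxx; lia.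
- case/mapP => a; rewrite mem_filter => /andP [ae _] ->; apply: clause_trueP => y t /=.
  case/and3P => /eqP -> y0 /eqP Ha _; have := @nth_last_letter (absz y).
  by rewrite Ha (negbTE ae); lia.
- case/mapP => s _ ->; apply: clause_trueP => y t; rewrite /= t1.
  move=> H1 /and3P [H2 H3 H4].
  have H0 : 1 <= t <= K%:Z by lia.
  have := run_step (running H0).
  have -> : (absz (t - 1)).+1 = absz t by lia.
  by case: (tm_delta _ _) => [[q' s'] d] [_ _ ->]; rewrite (eqP H4);
    case: (eqVneq y (head _)) => [Ey|_]; rewrite ?eqxx; lia.
- case/mapP => s _ ->; apply: clause_trueP => y t; rewrite /=; lia.
- case/mapP => s _ ->; apply: clause_trueP => y t; rewrite /= t1.
  move=> H1 /and3P [H2 H3 H4].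
  have H0 : 1 <= t <= K%:Z by lia.
  have := run_step (running H0).
  have -> : (absz (t - 1)).+1 = absz t by lia.
  by case: (tm_delta _ _) => [[q' s'] d] [_ _ ->]; rewrite (eqP H4);
    case: (eqVneq (y - 1) (head _)) => [Ey|_]; rewrite ?eqxx; lia.
- case/mapP => s _ ->; apply: clause_trueP => y t; rewrite /=; lia.
- case/flatten_mapP => q _ /flatten_mapP [s _]; exact: head_clauses_true.
Qed.

Lemma true_fact_closed c j t r : (r < size program)%N -> rom_enabled w c r ->
  true_fact (rule_input_a program c j t r) -> true_fact (rule_input_b program c j t r) ->
  true_fact (rule_output program c j t r).
Proof.
move=> rR en; rewrite /rule_input_a /rule_input_b /rule_output.
have [x [xc Ex ->]] := the_rule_program rR; rewrite /=.
have [rna|rna] := ltnP r na; last first.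
  apply: other_clauses_true; rewrite Ex nth_cat size_rom_clauses ltnNge rna /=.
  by rewrite mem_nth // -(ltn_add2l na) subnKC // -size_program.
rewrite Ex nth_cat size_rom_clauses rna (nth_map (Ordinal rna)) ?size_enum_ord //=.
have -> : nth (Ordinal rna) (enum 'I_na) r = Ordinal rna.
  by apply: val_inj; rewrite /= nth_enum_ord.
rewrite !port_factE !true_factE (_ : t + (false : nat)%:Z = t); last by lia.
rewrite (_ : c - (false : nat)%:Z = c); last by lia.
move=> /andP [-> Hi] _.
have t0 : t = 0 by move: Hi => /=; lia.
by subst t; apply: spacetime_init.
Qed.

Lemma spacetime_bounded v x t : spacetime v x t ->
  - (n + K + 2)%:Z <= x <= (n + K + 2)%:Z /\ - (n + K + 2)%:Z <= t <= (n + K + 2)%:Z.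
Proof.
by case: v => [||||||||a|s|q] /=; have := head_bound (absz (t - 1)); lia.
Qed.

Lemma program_halting : ~ infinitely_many_topplings program_config.
Proof.
apply: (layout_finite program_well_formed program_gt0 true_fact_closed _ _ (b := n + K + 2)).
- by rewrite /num_vars.
- by rewrite (true_factE Start) /= !eqxx.
move=> v c j t; rewrite /true_fact; case: eqP => //= ->.
by case: excluded_middle_informative => // -[v' _ /spacetime_bounded [Hc Ht]] _; split=> //;
  lia.
Qed.
End Halting.


(** * Derivations along a run that never halts *)

Section Nonhalting.

Hypothesis never_halted : forall k, ~~ tm_halted (run k).

Definition holds (v : var) (x t : int) : Prop :=
  derivable program (rom_enabled w) (var_index v, x, 0, t).

Lemma holds_clause (a b c : var * bool) (up : bool) x t :
  clause a b c up \in other_clauses ->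
  holds a.1 (if a.2 then x - 1 else x) t -> holds b.1 (if b.2 then x - 1 else x) t ->
  holds c.1 (if c.2 then x - 1 else x) (if up then t + 1 else t).
Proof.
move=> cin Ha Hb; pose i := index (clause a b c up) other_clauses.
have iR : (na + i < size program)%N by rewrite size_program ltn_add2l index_mem.
have Hr : the_rule program (na + i) = Rule (port a) (port b) (port c) up.
  have [y [_ -> ->]] := the_rule_program iR.
  by rewrite nth_cat size_rom_clauses ltnNge leq_addr /= addKn nth_index.
have E (d : bool) : x - (d : nat)%:Z = if d then x - 1 else x by case: d => //; lia.
have Eup : t + (up : nat)%:Z = if up then t + 1 else t by case: (up) => //; lia.
have Et : t + (false : nat)%:Z = t by lia.
have en : rom_enabled w x (na + i) by rewrite /rom_enabled ltnNge leq_addr.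
have := @DerivableRule program (rom_enabled w) x 0 t _ iR en.
rewrite /rule_input_a /rule_input_b /rule_output Hr [rule_a _]/= [rule_b _]/= [rule_c _]/=
  [rule_up _]/=.
case: a b c {cin i iR Hr en} Ha Hb => [a da] [b db] [c dc] Ha Hb.
by rewrite !port_factE !E Eup Et; apply.
Qed.

Lemma holds_letter x : (x < n)%N -> holds Init (x%:Z - 1) 0 ->
  holds (Letter (nth e w x)) x%:Z 0.
Proof.
move=> xn HI; set a := nth e w x.
have iR : (a < size program)%N by rewrite size_program; have := ltn_ord a; lia.
have Hr : the_rule program a = Rule (port (left Init)) (port (left Init)) (port (here (Letter
  a))) false.
  have [y [_ -> ->]] := the_rule_program iR.
  by rewrite nth_cat size_rom_clauses ltn_ord (nth_map a) ?size_enum_ord // nth_ord_enum.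
have en : rom_enabled w x%:Z a by rewrite /rom_enabled rom_letterE // ltn_ord /= eqxx.
have := @DerivableRule program (rom_enabled w) x%:Z 0 0 _ iR en.
rewrite /rule_input_a /rule_input_b /rule_output Hr [rule_a _]/= [rule_b _]/= [rule_c _]/=
  [rule_up _]/=.
rewrite !port_factE (_ : x%:Z - (false : nat)%:Z = x%:Z); last by lia.
by move=> /(_ HI HI).
Qed.

Lemma in_other_clauses i x : (i < 10)%N ->
  x = nth x (take 10 other_clauses) i -> x \in other_clauses.
Proof.
move=> i10 ->; apply: (@mem_take 10); apply: mem_nth.
by rewrite size_takel // /other_clauses size_cat /=; lia.
Qed.

Lemma holds_start : holds Start 0 0.
Proof. exact: DerivableStart. Qed.

Lemma holds_start_head : holds (Head (tm_start M)) 0 1.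
Proof.
apply: (@holds_clause (here Start) (here Start) (here (Head _)) true 0 0);
  [exact: (@in_other_clauses 0)|exact: holds_start|exact: holds_start].
Qed.

Lemma holds_start_mark : holds LMark (-1) 1.
Proof.
apply: (@holds_clause (here Start) (here Start) (left LMark) true 0 0);
  [exact: (@in_other_clauses 1)|exact: holds_start|exact: holds_start].
Qed.

Lemma holds_init x : (x < n)%N -> holds Init (x%:Z - 1) 0.
Proof.
elim: x => [|x IH] xn.
  apply: (@holds_clause (here Start) (here Start) (left Init) false 0 0);
    [exact: (@in_other_clauses 2)|exact: holds_start|exact: holds_start].
have xn' := ltnW xn; have HL := holds_letter xn' (IH xn').
have -> : x.+1%:Z - 1 = x%:Z by lia.
set a := nth e w x in HL.
apply: (@holds_clause (here (Letter a)) (here (Letter a)) (here Init) false x%:Z 0) => //.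
rewrite !mem_cat; apply/orP; right; apply/orP; right; apply/orP; left.
apply: (map_f (fun a => clause (here (Letter a)) (here (Letter a)) (here Init) false)).
by rewrite mem_filter mem_enum andbT nth_last_letter //; lia.
Qed.

Lemma holds_first_row :
  [/\ forall x : int, -1 < x < n%:Z -> holds (Sym (tape 0 x)) x 1,
      holds (Head (cfg_state (run 0))) (head 0) 1,
      holds LMark (-1) 1 & holds RMark n%:Z 1].
Proof.
split; [|exact: holds_start_head|exact: holds_start_mark|].
  case=> x // xn; have {}xn : (x < n)%N by lia.
  have HL := holds_letter xn (holds_init xn).
  rewrite /run /= onthE (nth_map e) //.
  set a := nth e w x in HL *.
  apply: (@holds_clause (here (Letter a)) (here (Letter a)) (here (Sym _)) true x%:Z 0) => //.
  rewrite !mem_cat; apply/orP; right; apply/orP; left.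
  apply: (map_f (fun a => clause (here (Letter a)) (here (Letter a))
            (here (Sym (tm_embed M (Some a)))) true)).
  by rewrite mem_enum.
have nn : (n.-1 < n)%N by have := rom_size_gt0; lia.
have HL := holds_letter nn (holds_init nn).
have Ee : nth e w n.-1 = e by apply/eqP; rewrite nth_last_letter // prednK // rom_size_gt0.
rewrite Ee in HL.
have HX : holds RExt n.-1%:Z 0.
  apply: (@holds_clause (here (Letter e)) (here (Letter e)) (here RExt) false _ 0) => //.
  exact: (@in_other_clauses 9).
apply: (@holds_clause (left RExt) (left RExt) (here RMark) true n%:Z 0);
  [exact: (@in_other_clauses 3)| |];
  by rewrite /= (_ : n%:Z - 1 = n.-1%:Z) //; have := rom_size_gt0; lia.
Qed.

Lemma holds_row k (t := k%:Z + 1) :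
  [/\ forall x : int, - t < x < n%:Z + t - 1 -> holds (Sym (tape k x)) x t,
      holds (Head (cfg_state (run k))) (head k) t,
      holds LMark (- t) t & holds RMark (n%:Z + t - 1) t].
Proof.
rewrite {}/t; elim: k => [|k].
  have [HS HH HL HR] := holds_first_row; split=> //.
  - by move=> x Hx; apply: HS; lia.
  - by have -> : n%:Z + (0%:Z + 1) - 1 = n%:Z by lia.
have -> : k.+1%:Z + 1 = k%:Z + 1 + 1 by lia.
set t := k%:Z + 1 => -[HS HH HL HR].
have := run_step (never_halted k); set q := cfg_state _ in HH *.
set s := tape k (head k); set h := head k in HH *.
case D: (tm_delta q s) => [[q' s'] d] [Eq Eh Et].
have hb := head_bound k; rewrite -/h in hb.
have HSh : holds (Sym s) h t by apply: HS; rewrite /t; have := rom_size_gt0; lia.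
have head_in x : x \in head_clauses q s -> x \in other_clauses.
  move=> xin; rewrite !mem_cat; do 7!(apply/orP; right).
  apply/flatten_mapP; exists q; first by rewrite mem_enum.
  by apply/flatten_mapP; exists s; first by rewrite mem_enum.
have Hd : head_clauses q s =
  [:: clause (here (Head q)) (here (Sym s)) (here (Sym s')) true;
      clause (here (Head q)) (here (Sym s)) (here RCopy) false;
      clause (here (Head q)) (here (Sym s)) (here LCopy) false;
      match d with
      | MoveLeft => clause (here (Head q)) (here (Sym s)) (left (Head q')) true
      | MoveRight => clause (left (Head q)) (left (Sym s)) (here (Head q')) true
      | Stay => clause (here (Head q)) (here (Sym s)) (here (Head q')) true
      end].
  by have := never_halted k; rewrite /tm_halted /head_clauses -/q D => /negbTE ->.
rewrite Hd in head_in.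
have copy_in (f : S -> nat * nat * nat * bool) x : f x \in [seq f s | s <- enum S].
  by apply: map_f; rewrite mem_enum.
have HRC (m : nat) : h + m%:Z < n%:Z + t - 1 -> holds RCopy (h + m%:Z) t.
  elim: m => [|m IH] Hm.
    rewrite addr0.
    apply: (@holds_clause (here (Head q)) (here (Sym s)) (here RCopy) false h t) => //.
    by apply: head_in; rewrite !inE eqxx ?orbT.
  have HSx : holds (Sym (tape k (h + m.+1%:Z))) (h + m.+1%:Z) t by apply: HS; rewrite /t; lia.
  apply: (@holds_clause (left RCopy) (here (Sym _)) (here RCopy) false _ t _ _ HSx).
    by rewrite !mem_cat; do 4!(apply/orP; right); apply/orP; left; apply: copy_in.
  by rewrite /= (_ : h + m.+1%:Z - 1 = h + m%:Z); [apply: IH|]; lia.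
have HLC (m : nat) : - t < h - m%:Z -> holds LCopy (h - m%:Z) t.
  elim: m => [|m IH] Hm.
    rewrite subr0.
    apply: (@holds_clause (here (Head q)) (here (Sym s)) (here LCopy) false h t) => //.
    by apply: head_in; rewrite !inE eqxx ?orbT.
  have HSx : holds (Sym (tape k (h - m.+1%:Z))) (h - m%:Z - 1) t.
    by rewrite (_ : h - m%:Z - 1 = h - m.+1%:Z); [apply: HS|]; rewrite /t; lia.
  rewrite (_ : h - m.+1%:Z = h - m%:Z - 1); last by lia.
  apply: (@holds_clause (here LCopy) (left (Sym _)) (left LCopy) false _ t _ _ HSx).
    by rewrite !mem_cat; do 6!(apply/orP; right); apply/orP; left; apply: copy_in.
  by apply: IH; lia.
(* The wave arrives in the cell just before the marker, where the clauses of the marker take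
   over. *)
have HRend : holds RCopy (n%:Z + t - 1 - 1) t.
  have -> : n%:Z + t - 1 - 1 = h + (absz (n%:Z + t - 2 - h)%R)%:Z by rewrite /t;
    have := rom_size_gt0; lia.
  by apply: HRC; rewrite /t; have := rom_size_gt0; lia.
have HLend : holds LCopy (- t + 1) t.
  have -> : - t + 1 = h - (absz (h + t - 1)%R)%:Z by rewrite /t; lia.
  by apply: HLC; rewrite /t; lia.
split.
- move=> x Hx; rewrite Et; case: (eqVneq x h) => [->|xh].
    apply: (@holds_clause (here (Head q)) (here (Sym s)) (here (Sym s')) true h t) => //.
    by apply: head_in; rewrite !inE eqxx ?orbT.
  have [xr|xr] := eqVneq x (n%:Z + t - 1).
    rewrite tape_blank; last by left; rewrite xr /t; have := rom_size_gt0; lia.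
    rewrite xr;
      apply: (@holds_clause (left RCopy) (here RMark) (here (Sym blank)) true _ t) => //.
    exact: (@in_other_clauses 5).
  have [xl|xl] := eqVneq x (- t).
    rewrite tape_blank; last by right; rewrite xl /t; lia.
    have -> : x = - t + 1 - 1 by lia.
    apply: (@holds_clause (here LCopy) (left LMark) (left (Sym blank)) true _ t) => //.
      exact: (@in_other_clauses 7).
    by rewrite /= addrK.
  have HSx : holds (Sym (tape k x)) x t by apply: HS; lia.
  have [hx|hx] : h < x \/ x < h by lia.
    apply: (@holds_clause (left RCopy) (here (Sym _)) (here (Sym _)) true _ t _ _ HSx).
      by rewrite !mem_cat; do 3!(apply/orP; right); apply/orP; left; apply: copy_in.
    have -> : (if (left RCopy).2 then x - 1 else x) = h + (absz (x - 1 - h)%R)%:Z by rewrite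
      /=; lia.
    by apply: HRC; lia.
  (* Clauses of the left wave belong to the cell to the right of the symbol they copy. *)
  have Ex : x = x + 1 - 1 by rewrite addrK.
  rewrite [X in holds _ X _]Ex in HSx; rewrite [X in holds _ X _]Ex.
  apply: (@holds_clause (here LCopy) (left (Sym _)) (left (Sym _)) true (x + 1) t _ _ HSx).
    by rewrite !mem_cat; do 5!(apply/orP; right); apply/orP; left; apply: copy_in.
  have -> : (if (here LCopy).2 then x + 1 - 1 else x + 1) = h - (absz (h - x - 1)%R)%:Z by
    rewrite /=; lia.
  by apply: HLC; lia.
- rewrite Eq Eh; have Hlast := head_in _ (mem_last _ _).
  rewrite /= in Hlast; case: d {D Eh Hd head_in} Hlast => Hlast /=.
  + exact: (@holds_clause _ _ (left (Head q')) true h t Hlast).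
  + apply: (@holds_clause _ _ (here (Head q')) true (h + 1) t Hlast); by rewrite /= addrK.
  + exact: (@holds_clause _ _ (here (Head q')) true h t Hlast).
- have HX : holds LExt (- t) t.
    have -> : - t = - t + 1 - 1 by lia.
    apply: (@holds_clause (here LCopy) (left LMark) (left LExt) false _ t) => //.
      exact: (@in_other_clauses 8).
    by rewrite /= addrK.
  rewrite (_ : - (t + 1) = - t - 1); last by lia.
  apply: (@holds_clause (here LExt) (here LExt) (left LMark) true _ t) => //.
- have HX : holds RExt (n%:Z + t - 1) t.
    apply: (@holds_clause (left RCopy) (here RMark) (here RExt) false _ t) => //.
    exact: (@in_other_clauses 6).
  apply: (@holds_clause (left RExt) (left RExt) (here RMark) true _ t).
  + exact: (@in_other_clauses 3).
  + by rewrite /= (_ : n%:Z + (t + 1) - 1 - 1 = n%:Z + t - 1) //; lia.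
  + by rewrite /= (_ : n%:Z + (t + 1) - 1 - 1 = n%:Z + t - 1) //; lia.
Qed.

Lemma program_nonhalting : infinitely_many_topplings program_config.
Proof.
apply: (layout_infinite program_well_formed program_gt0); first by rewrite /num_vars.
case=> [|k]; first by exists (var_index Start), 0, 0; exact: DerivableStart.
have [_ HH _ _] := holds_row k; exists (var_index (Head (cfg_state (run k)))), (head k), 0.
by move: HH; rewrite /holds (_ : k%:Z + 1 = k.+1%:Z) //; lia.
Qed.

End Nonhalting.

Lemma program_configP :
  infinitely_many_topplings program_config <-> forall k, ~~ tm_halted (run k).
Proof.
split=> [Hinf k|]; last exact: program_nonhalting.
apply/negP => Hk; have Hex : exists k, tm_halted (run k) by exists k.
move: Hinf; case: (ex_minnP Hex) => K HK Kmin; apply: (program_halting HK) => k' k'K.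
by apply/negP => /Kmin; lia.
Qed.

End Program.

(** * The encoding of the simulating configuration *)

Notation symbol := 'I_7.
Definition hash : symbol := @Ordinal 7 4 isT.
Definition hole : symbol := @Ordinal 7 5 isT.
Definition final : symbol := @Ordinal 7 6 isT.

Definition symbol_of_letter (l : letter) : symbol :=
  match l with
  | Bit false => @Ordinal 7 0 isT
  | Bit true => @Ordinal 7 1 isT
  | Minus => @Ordinal 7 2 isT
  | Separator => @Ordinal 7 3 isT
  end.

Definition letter_of_symbol (a : symbol) : letter :=
  match val a with
  | 0%N => Bit false
  | 1%N => Bit true
  | 2%N => Minus
  | _ => Separator
  end.

Lemma symbol_of_letterK : cancel symbol_of_letter letter_of_symbol.
Proof. by case=> [[]| |]. Qed.

Definition hole_letter (a : symbol) (k : nat) : letter :=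
  if a == k :> nat then Bit false else Minus.

(* The gate height 2 is encoded by [[:: Bit false; Bit true; Separator]] and the
   inert height -1 by [[:: Minus; Bit true; Separator]]: a ROM gate only affects the
   first letter. The holes occur in the order of the letters they test. *)
Fixpoint fill (a : symbol) (k : nat) (s : seq symbol) : seq letter :=
  if s is x :: s' then
    if x == hole then hole_letter a k :: fill a k.+1 s'
    else letter_of_symbol x :: fill a k s'
  else [::].

Lemma fill_letters a k (s : seq letter) t :
  fill a k (map symbol_of_letter s ++ t) = s ++ fill a k t.
Proof. by elim: s => [|[[]| |] s IH] //=; rewrite IH. Qed.

Lemma notin_letters (a : symbol) (s : seq letter) :
  (3 < a)%N -> a \notin map symbol_of_letter s.
Proof.
move=> a3; elim: s => //= l s IH; rewrite inE negb_or IH andbT -val_eqE.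
by case: l => [[]| |] /=; lia.
Qed.

Lemma flatten_iota_mul (T : Type) (f : nat -> seq T) m n :
  flatten [seq f x | x <- iota 0 (m * n)] =
  flatten [seq flatten [seq f (i * m + x)%N | x <- iota 0 m] | i <- iota 0 n].
Proof.
elim: n => [|n IH]; first by rewrite muln0.
rewrite mulnS addnC -[n.+1]addn1 !iotaD !map_cat !flatten_cat IH !add0n /= cats0.
have -> : iota (m * n) m = iota (m * n + 0) m by rewrite addn0.
rewrite iotaDl -map_comp; congr (_ ++ flatten _).
by apply: eq_map => x /=; rewrite mulnC.
Qed.

Lemma flatten_map_flatten (T1 T2 : Type) (f : T1 -> seq T2) ss :
  flatten [seq f x | x <- flatten ss] = flatten [seq flatten [seq f x | x <- s] | s <- ss].
Proof. by elim: ss => //= s ss IH; rewrite map_cat flatten_cat IH. Qed.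

Lemma flatten_map3 (T1 T2 : Type) (f : T1 -> seq T2) a b c :
  flatten [seq f x | x <- [:: a; b; c]] = f a ++ f b ++ f c.
Proof. by rewrite /= cats0. Qed.

Section Encoding.

Variables (M : turing_machine symbol) (u : seq symbol).

Notation w := (rcons u final).
Notation rules := (program final M).
Notation nv := (num_vars M).
Notation wd := (width rules).
Notation dp := (depth nv).

Definition local_height (a : symbol) (c : nat * nat * nat) : int :=
  match local_kind nv rules c.1.1 c.1.2 c.2 with
  | Inert => -1
  | Wire _ _ => 5
  | Gate r => if (r < 7)%N ==> (a == r :> nat) then 2 else -1
  end.

Definition background : configuration := layout_height nv rules (rom_enabled final w).

Lemma backgroundE x y z : background (x, y, z) =
  local_height (rom_letter final w (x %/ wd)%Z)
    (local_coord wd x, local_coord dp y, local_coord 6 z).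
Proof. by []. Qed.

Lemma local_coord_mod (n : nat) (x x' : int)
  : (x = x' %[mod n])%Z -> local_coord n x = local_coord n x'.
Proof. by rewrite /local_coord => ->. Qed.

Lemma divz_mod_mul (x x' : int) (m n : nat) : (0 < m)%N -> (0 < n)%N ->
  (x = x' %[mod (m * n)%N])%Z ->
  (x = x' %[mod m])%Z /\ ((x %/ m)%Z = (x' %/ m)%Z %[mod n])%Z.
Proof.
move=> m0 n0 /eqP; rewrite eqz_mod_dvd => /dvdzP [q Hq].
have -> : x = (q * n) * m + x' by rewrite PoszM in Hq; lia.
split; first by rewrite modzMDl.
by rewrite divzMDl ?modzMDl //; lia.
Qed.

Lemma background_periodic : periodic (wd * size w) dp 6 background.
Proof.
move=> x y z x' y' z' Hx Hy Hz; rewrite !backgroundE.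
have [Hx1 Hx2] := divz_mod_mul (width_gt0 rules) (rom_size_gt0 final u) Hx.
rewrite (local_coord_mod Hx1) (local_coord_mod Hy) (local_coord_mod Hz).
by rewrite /rom_letter (local_coord_mod Hx2).
Qed.

Definition chip (v : vertex) : nat := (v == (0, 0, 0)).

Lemma chip_support v : (v \in [:: (0, 0, 0) : vertex]) = (chip v != 0%N).
Proof. by rewrite inE /chip; case: eqP. Qed.

Lemma nx_gt0 : (0 < wd * size w)%N.
Proof. by rewrite muln_gt0 width_gt0 size_rcons. Qed.

Definition instance : pf_config :=
  PFConfig nx_gt0 (depth_gt0 nv) (isT : 0 < 6)%N background_periodic
    (isT : uniq [:: (0, 0, 0) : vertex]) chip_support.

Lemma instance_infinite : final \notin u ->
  infinitely_many_topplings (pf_initial instance) <->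
  forall k, ~~ tm_halted (iter k (@tm_step _ M) (tm_init M w)).
Proof. exact: program_configP. Qed.

Definition cells : seq (nat * nat * nat) :=
  [seq (x, yz.1, yz.2) | x <- iota 0 wd,
     yz <- [seq (y, z) | y <- iota 0 dp, z <- iota 0 6]].

Definition block (a : symbol) : seq letter :=
  flatten [seq encode_int (local_height a c) | c <- cells].

Definition header (n : nat) : seq letter :=
  encode_int (wd * n)%N ++ encode_int dp ++ encode_int 6.

(** The support entry of the added chip: 0 is encoded by a lone [Separator], so the three
    coordinates give three of them, followed by the numeral 1. *)
Definition chip_code : seq letter :=
  [:: Separator; Separator; Separator; Bit true; Separator].

(** The encoding has x as its outermost index, and a period in y and z is a single cell; so the
    heights split into one block per cell, determined by its ROM letter. *)
Lemma encode_instance :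
  encode instance = header (size w) ++ flatten [seq block a | a <- w] ++ chip_code.
Proof.
pose row x := [seq background (x, y%:Z, z%:Z) | y <- iota 0 dp, z <- iota 0 6].
have -> : encode instance = header (size w)
    ++ flatten [seq flatten [seq encode_int h | h <- row x%:Z] | x <- iota 0 (wd * size w)]
    ++ chip_code.
  rewrite /encode /pf_data !map_cat !flatten_cat flatten_map_flatten -map_comp.
  by rewrite /header -flatten_map3.
congr (_ ++ (_ ++ _)); rewrite flatten_iota_mul -[X in [seq block a | a <- X]](mkseq_nth final).
rewrite -map_comp; congr flatten; apply/eq_in_map => i.
rewrite mem_iota add0n => /andP [_ iw];
  rewrite /comp /block /cells flatten_map_flatten -map_comp.
congr flatten; apply/eq_in_map => x; rewrite mem_iota add0n => /andP [_ xw].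
rewrite /comp [in RHS]map_comp; congr (flatten (map _ _)).
rewrite -map_comp /row map_allpairs; apply/eq_in_allpairs => y z.
rewrite !mem_iota !add0n => /andP [_ yd] /andP [_ z6].
rewrite backgroundE PoszD PoszM.
have [-> ->] := local_coordE i xw.
have Hy := local_coordE 0 yd; rewrite mul0r add0r in Hy; have [-> _] := Hy.
have Hz := @local_coordE 6 0 _ z6; rewrite mul0r add0r in Hz; have [-> _] := Hz.
by rewrite rom_letterE.
Qed.

Definition rom_gate (c : nat * nat * nat) : option nat :=
  if local_kind nv rules c.1.1 c.1.2 c.2 is Gate r then
    if (r < 7)%N then Some r else None
  else None.

Definition template_cell (c : nat * nat * nat) : seq symbol :=
  if rom_gate c is Some _ then hole :: map symbol_of_letter [:: Bit true; Separator]
  else map symbol_of_letter (encode_int (local_height final c)).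

Definition template : seq symbol := flatten [seq template_cell c | c <- cells].

(** The hypothesis keeps the hole counter in step with the gates: the next ROM gate in [cs], if any,
    tests letter [k]. *)
Lemma fill_template_cells a k m (cs : seq (nat * nat * nat)) :
  pmap rom_gate cs = iota k m ->
  fill a k (flatten [seq template_cell c | c <- cs]) =
  flatten [seq encode_int (local_height a c) | c <- cs].
Proof.
elim: cs k m => [//|c cs IH] k m; rewrite !map_cons /= /template_cell.
case Ec: (rom_gate c) => [r|] /=.
  case: m => [//|m] [rk /IH <-].
  move: Ec; rewrite rk; rewrite /rom_gate /local_height /hole_letter.
  case: (local_kind _ _ _ _ _) => // r'; case: ifP => // _ [->] /=.
  by case: (a == k :> nat).
move/IH <-; rewrite fill_letters; congr (_ ++ _).
move: Ec; rewrite /rom_gate /local_height.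
by case: (local_kind _ _ _ _ _) => // r'; case: ifP => // ->.
Qed.

Lemma rom_gateE x y z : (x < wd)%N ->
  rom_gate (x, y, z) =
  if ((x %% 6 == 2) && (x %/ 6 < 7))%N && ((y, z) == (gate_y nv, 2%N))
  then Some (x %/ 6)%N else None.
Proof.
move=> xw; rewrite /rom_gate /=.
case E: (local_kind _ _ _ _ _) => [|p up|r].
- rewrite ifF //; apply/negP => /andP [/andP [/eqP x2 x7] /eqP [Ey Ez]]; subst y z.
  have rR : (x %/ 6 < size rules)%N by rewrite size_program; lia.
  move: E; rewrite /local_kind /column_kind rR x2; case: (the_rule _ _) => a b c up.
  by rewrite eqxx ifF //; rewrite /gate_y; lia.
- rewrite ifF //; apply/negP => /andP [/andP [/eqP x2 x7] /eqP [Ey Ez]]; subst y z.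
  have rR : (x %/ 6 < size rules)%N by rewrite size_program; lia.
  move: E; rewrite /local_kind /column_kind rR x2; case: (the_rule _ _) => a b c up'.
  by rewrite eqxx ifF //; rewrite /gate_y; lia.
- have [-> -> -> rR] := local_kind_gate (@program_well_formed _ final M) (program_gt0 final
  M) E.
  rewrite eqxx andbT; have -> : ((6 * r + 2) %% 6 = 2)%N by lia.
  by have -> : ((6 * r + 2) %/ 6 = r)%N by lia.
Qed.

Lemma pmap_single (T : eqType) (T' : Type) (f : T -> option T') (s : seq T) x0 r :
  uniq s -> x0 \in s -> (forall x, f x = if x == x0 then Some r else None) ->
  pmap f s = [:: r].
Proof.
move=> us xs Hf; have {Hf} -> : pmap f s = map (fun=> r) (filter (pred1 x0) s).
  by elim: s {us xs} => //= x s IH; rewrite Hf /=; case: ifP => _ /=; rewrite IH.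
by rewrite filter_pred1_uniq.
Qed.

Lemma pmap_none (T T' : Type) (f : T -> option T') (s : seq T) :
  (forall x, f x = None) -> pmap f s = [::].
Proof. by move=> H; elim: s => //= x s IH; rewrite H. Qed.

Lemma pmap_flatten (T T' : Type) (f : T -> option T') (ss : seq (seq T)) :
  pmap f (flatten ss) = flatten (map (pmap f) ss).
Proof. by elim: ss => //= s ss IH; rewrite pmap_cat IH. Qed.

Lemma pmap_map (T1 T2 T3 : Type) (f : T2 -> option T3) (g : T1 -> T2) (s : seq T1) :
  pmap f (map g s) = pmap (f \o g) s.
Proof. by elim: s => //= x s IH; rewrite IH. Qed.

Lemma rom_gates : pmap rom_gate cells = iota 0 7.
Proof.
rewrite /cells pmap_flatten -map_comp.
pose col x := if ((x %% 6 == 2) && (x %/ 6 < 7))%N then [:: x %/ 6]%N else [::].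
have -> : flatten [seq pmap rom_gate (map (fun yz => (x, yz.1, yz.2))
      [seq (y, z) | y <- iota 0 dp, z <- iota 0 6]) | x <- iota 0 wd] =
    flatten [seq col x | x <- iota 0 wd].
  congr flatten; apply/eq_in_map => x; rewrite mem_iota add0n => /andP [_ xw].
  rewrite pmap_map /col; case: ifP => Hx.
    apply: (@pmap_single _ _ _ _ (gate_y nv, 2%N)).
    - by apply: allpairs_uniq; rewrite ?iota_uniq // => -[? ?] [? ?].
    - by apply: (allpairs_f pair); rewrite mem_iota //= add0n /gate_y /depth; lia.
    - by case=> y z; rewrite /comp [_.1]/= [_.2]/= rom_gateE // Hx.
  by apply: pmap_none => -[y z]; rewrite /comp [_.1]/= [_.2]/= rom_gateE // Hx.
(* Seven ROM rules of six columns each: every hole has x below 42. *)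
have -> : wd = (42 + (wd - 42))%N by rewrite /width size_program; lia.
rewrite iotaD map_cat flatten_cat.
have -> : flatten [seq col x | x <- iota (0 + 42) (wd - 42)] = [::].
  rewrite (_ : [seq col x | x <- _] = [seq [::] | x <- iota (0 + 42) (wd - 42)]).
    by elim: (iota _ _).
  apply/eq_in_map => x; rewrite mem_iota => /andP [Hx _].
  by rewrite /col ifF //; lia.
by rewrite cats0.
Qed.

Lemma fill_template a : fill a 0 template = block a.
Proof. exact: fill_template_cells rom_gates. Qed.

Lemma notin_template (a : symbol) : (3 < a)%N -> a != hole -> a \notin template.
Proof.
move=> a3 ah; apply/flatten_mapP => -[c _]; apply/negP; rewrite /template_cell.
case: (rom_gate c) => [r|]; last exact: notin_letters.
by rewrite in_cons negb_or ah; apply: notin_letters.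
Qed.

End Encoding.

(** * A machine that rebuilds an encoding and runs a decider on it *)

Section Reachability.

Variables (A : Type) (M : turing_machine A).

Definition reaches (c c' : tm_config M) : Prop := exists k, iter k (@tm_step _ M) c = c'.

Lemma reaches_refl c : reaches c c. Proof. by exists 0%N. Qed.

Lemma reaches_trans c2 c1 c3 : reaches c1 c2 -> reaches c2 c3 -> reaches c1 c3.
Proof. by move=> [k <-] [l <-]; exists (l + k)%N; rewrite iterD. Qed.

Notation halting q := ((q == tm_accept M) || (q == tm_reject M)).

Lemma reaches_write q h t q' a d t' : ~~ halting q -> tm_delta q (t h) = (q', a, d) ->
  (forall i, (if i == h then a else t i) = t' i) ->
  reaches (TMConfig q h t) (TMConfig q' (shift d h) t').
Proof.
move=> Hq Hd /functional_extensionality <-; exists 1%N.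
by rewrite /= /tm_step /tm_halted /= (negbTE Hq) Hd.
Qed.

Lemma reaches_move q h t q' d : ~~ halting q -> tm_delta q (t h) = (q', t h, d) ->
  reaches (TMConfig q h t) (TMConfig q' (shift d h) t).
Proof.
by move=> Hq Hd; apply: (reaches_write Hq Hd) => i; case: eqP => // ->.
Qed.

Lemma reaches_right q t (h : int) (m : nat) : ~~ halting q ->
  (forall i : nat, (i < m)%N -> tm_delta q (t (h + i%:Z)) = (q, t (h + i%:Z), MoveRight)) ->
  reaches (TMConfig q h t) (TMConfig q (h + m%:Z) t).
Proof.
move=> Hq; elim: m => [|m IH] H; first by rewrite addr0; apply: reaches_refl.
apply: reaches_trans (IH _) _ => [i im|]; first by apply: H; lia.
have -> : h + m.+1%:Z = shift MoveRight (h + m%:Z) by rewrite /=; lia.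
by apply: reaches_move => //; apply: H.
Qed.

Lemma reaches_left q t (h : int) (m : nat) : ~~ halting q ->
  (forall i : nat, (i < m)%N -> tm_delta q (t (h - i%:Z)) = (q, t (h - i%:Z), MoveLeft)) ->
  reaches (TMConfig q h t) (TMConfig q (h - m%:Z) t).
Proof.
move=> Hq; elim: m => [|m IH] H; first by rewrite subr0; apply: reaches_refl.
apply: reaches_trans (IH _) _ => [i im|]; first by apply: H; lia.
have -> : h - m.+1%:Z = shift MoveLeft (h - m%:Z) by rewrite /=; lia.
by apply: reaches_move => //; apply: H.
Qed.

Lemma iter_halted k (c : tm_config M) : tm_halted c -> iter k (@tm_step _ M) c = c.
Proof. by move=> Hc; elim: k => //= k ->; rewrite /tm_step Hc. Qed.

Lemma reaches_fixed c c' : reaches c c' -> tm_step c' = c' -> ~~ tm_halted c' ->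
  forall k, ~~ tm_halted (iter k (@tm_step _ M) c).
Proof.
move=> [l Hl] Hfix Hc' k; apply: contra Hc' => Hk.
have E m : iter m (@tm_step _ M) c' = c' by elim: m => //= m ->.
by rewrite -(E k) -Hl -iterD addnC iterD iter_halted.
Qed.

End Reachability.

(** The argument in ['I_8] is the saturating count of holes met in the current copy; the one in
    ['I_5] is a position in [chip_code]. *)
Inductive phase (Q : Type) : Type :=
  | Seek | Copy of symbol & 'I_8 | Carry of symbol & 'I_8 & symbol
  | Return of symbol & 'I_8 | RewindNext | Next | Rewind of symbol
  | Suffix of 'I_5 | Back | Simulate of Q | Accepted | Rejected.

Arguments Seek {Q}.
Arguments Copy {Q}.
Arguments Carry {Q}.
Arguments Return {Q}.
Arguments RewindNext {Q}.
Arguments Next {Q}.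
Arguments Rewind {Q}.
Arguments Suffix {Q}.
Arguments Back {Q}.
Arguments Accepted {Q}.
Arguments Rejected {Q}.

Definition phase_code (Q : finType) (q : phase Q) :
    'I_6 + symbol * 'I_8 + symbol * 'I_8 * symbol + symbol * 'I_8 + symbol + 'I_5 + Q :=
  match q with
  | Seek => inl (inl (inl (inl (inl (inl (@Ordinal 6 0 isT))))))
  | RewindNext => inl (inl (inl (inl (inl (inl (@Ordinal 6 1 isT))))))
  | Next => inl (inl (inl (inl (inl (inl (@Ordinal 6 2 isT))))))
  | Back => inl (inl (inl (inl (inl (inl (@Ordinal 6 3 isT))))))
  | Accepted => inl (inl (inl (inl (inl (inl (@Ordinal 6 4 isT))))))
  | Rejected => inl (inl (inl (inl (inl (inl (@Ordinal 6 5 isT))))))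
  | Copy p k => inl (inl (inl (inl (inl (inr (p, k))))))
  | Carry p k s => inl (inl (inl (inl (inr (p, k, s)))))
  | Return p k => inl (inl (inl (inr (p, k))))
  | Rewind p => inl (inl (inr p))
  | Suffix j => inl (inr j)
  | Simulate q => inr q
  end.

Definition phase_decode (Q : finType)
    (c : 'I_6 + symbol * 'I_8 + symbol * 'I_8 * symbol + symbol * 'I_8 + symbol + 'I_5 + Q) :
    phase Q :=
  match c with
  | inl (inl (inl (inl (inl (inl i))))) =>
      nth Seek [:: Seek; RewindNext; Next; Back; Accepted; Rejected] i
  | inl (inl (inl (inl (inl (inr (p, k)))))) => Copy p k
  | inl (inl (inl (inl (inr (p, k, s))))) => Carry p k s
  | inl (inl (inl (inr (p, k)))) => Return p k
  | inl (inl (inr p)) => Rewind p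
  | inl (inr j) => Suffix j
  | inr q => Simulate q
  end.

Lemma phase_codeK (Q : finType) : cancel (@phase_code Q) (@phase_decode Q).
Proof. by case. Qed.

HB.instance Definition _ (Q : finType) := Finite.copy (phase Q) (can_type (@phase_codeK Q)).

Section Machine.

Variable D : turing_machine letter.

Notation blank := (tm_embed D None).

(** The second track keeps the input symbol with two flags: already used as a parameter, and marked
    as being copied. It is [None] off the input, which makes both ends of the input recognisable. *)
Definition track : finType := (tm_symbol D * option (symbol * bool * bool))%type.

Definition track_embed (o : option symbol) : track :=
  (blank, omap (fun s => (s, false, false)) o).

Lemma track_embed_inj : injective track_embed.
Proof. by move=> [a|] [b|] // [->]. Qed.

(* Only the comparison of the hole counter with a letter, at most 6, matters. *)
Definition saturate (k : nat) : 'I_8 := inord (minn k 7).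

Definition write_letter (l : letter) : tm_symbol D := tm_embed D (Some l).

(* On an input [t ++ hash :: h ++ hash :: rest], the machine copies [h] (with the
   marked symbol in [Copy]/[Carry]/[Return]) behind the input, on the first track;
   then, for each input symbol [a] (flagged in [Next]), it copies [t] with its holes
   filled for [a]; then it writes [chip_code] and simulates [D] on the first track.
   It loops if [D] rejects. *)
Definition transition (q : phase (tm_state D)) (x : track) : phase (tm_state D) * track *
  move :=
  let: (d, o) := x in
  match q, o with
  | Seek, Some (s, _, _) => (if s == hash then Copy final (saturate 0) else Seek, x, MoveRight)
  | Copy p k, Some (s, f, _) =>
      if s == hash then (RewindNext, x, MoveLeft)
      else (if s == hole then Carry p (saturate k.+1) (symbol_of_letter (hole_letter p k))
            else Carry p k s, (d, Some (s, f, true)), MoveRight)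
  | Carry p k s, None =>
      if d == blank then (Return p k, (write_letter (letter_of_symbol s), None), MoveLeft)
      else (Carry p k s, x, MoveRight)
  | Carry p k s, Some _ => (Carry p k s, x, MoveRight)
  | Return p k, Some (s, f, true) => (Copy p k, (d, Some (s, f, false)), MoveRight)
  | Return p k, _ => (Return p k, x, MoveLeft)
  | RewindNext, Some _ => (RewindNext, x, MoveLeft)
  | RewindNext, None => (Next, x, MoveRight)
  | Next, Some (s, true, _) => (Next, x, MoveRight)
  | Next, Some (s, false, m) => (Rewind s, (d, Some (s, true, m)), MoveLeft)
  | Next, None => (Suffix ord0, x, Stay)
  | Rewind p, Some _ => (Rewind p, x, MoveLeft)
  | Rewind p, None => (Copy p (saturate 0), x, MoveRight)
  | Suffix j, _ =>
      if d == blank then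
        (if j == ord_max then Back else Suffix (inord j.+1),
         (write_letter (nth Separator chip_code j), o),
         if j == ord_max then MoveLeft else MoveRight)
      else (q, x, MoveRight)
  | Back, None => (Back, x, MoveLeft)
  | Back, Some _ => (Simulate (tm_start D), x, MoveRight)
  | Simulate q', _ =>
      if q' == tm_accept D then (Accepted, x, Stay)
      else if q' == tm_reject D then (q, x, Stay)
      else let: (q'', d', m) := tm_delta q' d in (Simulate q'', (d', o), m)
  | _, _ => (q, x, Stay)
  end.

Definition machine : turing_machine symbol :=
  @TuringMachine symbol (phase (tm_state D)) track track_embed track_embed_inj
    Seek Accepted Rejected isT transition.

(** * The run of the machine on a self-describing input *)

Section Run.

Variables (tmpl rest : seq symbol) (hdr : seq letter).
Hypothesis tmpl_hash : hash \notin tmpl.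

Definition rom_word : seq symbol :=
  tmpl ++ hash :: map symbol_of_letter hdr ++ hash :: rest.

Notation n := (size rom_word).

(* Letters already used as parameter of a template copy are the first [f] ones;
   [m] is the position of the mark; [out] is written after the rom_word. *)
Definition tape (f : nat) (m : option nat) (out : seq letter) (x : int) : tm_symbol machine :=
  if x is Posz i then
    if (i < n)%N then (blank, Some (nth hash rom_word i, (i < f)%N, m == Some i))
    else (tm_embed D (onth out (i - n)), None)
  else (blank, None).

Notation config q h t := (@TMConfig _ machine q h t).

Lemma tape_in f m out i : (i < n)%N ->
  tape f m out i%:Z = (blank, Some (nth hash rom_word i, (i < f)%N, m == Some i)).
Proof. by rewrite /tape => ->. Qed.

Lemma tape_out f m out i : tape f m out (n + i)%N%:Z = (tm_embed D (onth out i), None).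
Proof. by rewrite /tape ltnNge leq_addr /= addKn. Qed.

Lemma embed_written (out : seq letter) i :
  (tm_embed D (onth out i) == blank) = (size out <= i)%N.
Proof.
case: (leqP (size out) i) => Hi; first by rewrite onth_default ?eqxx.
by apply/negP => /eqP /(@tm_embed_inj _ D); have := onthTE out i; rewrite Hi; case: onth.
Qed.

Lemma tape_rcons f m out l x :
  (if x == (n + size out)%N%:Z then (write_letter l, None) else tape f m out x) =
  tape f m (rcons out l) x.
Proof.
case: eqP => [->|Hx]; first by rewrite tape_out onthE map_rcons nth_rcons size_map ltnn eqxx.
case: x Hx => // i Hx; rewrite /tape; case: ltnP => // ni.
congr (tm_embed D _, _); rewrite !onthE map_rcons nth_rcons size_map.
by case: ltngtP => // Hi; [rewrite nth_default // size_map; lia|lia].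
Qed.

Lemma tape_mark f out i x : (i < n)%N ->
  (if x == i%:Z then (blank, Some (nth hash rom_word i, (i < f)%N, true)) else tape f None
    out x) =
  tape f (Some i) out x.
Proof.
move=> iN; case: eqP => [->|Hx]; first by rewrite tape_in ?eqxx.
case: x Hx => // j Hj; rewrite /tape; case: ifP => // _.
by have -> : (Some i == Some j) = false by apply/eqP => -[E]; case: Hj; rewrite E.
Qed.

Lemma tape_unmark f out i x : (i < n)%N ->
  (if x == i%:Z then (blank, Some (nth hash rom_word i, (i < f)%N, false)) else tape f (Some
    i) out x) =
  tape f None out x.
Proof.
move=> iN; case: eqP => [->|Hx]; first by rewrite tape_in.
case: x Hx => // j Hj; rewrite /tape; case: ifP => // _.
by have -> : (Some i == Some j) = false by apply/eqP => -[E]; case: Hj; rewrite E.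
Qed.

Lemma tape_flag f out x : (f < n)%N ->
  (if x == f%:Z then (blank, Some (nth hash rom_word f, true, false)) else tape f None out x) =
  tape f.+1 None out x.
Proof.
move=> fN; case: eqP => [->|Hx]; first by rewrite tape_in // ltnSn.
case: x Hx => // j Hj; rewrite /tape; case: ifP => // _.
by have -> : (j < f)%N = (j < f.+1)%N by rewrite ltnS [RHS]leq_eqVlt; case: eqP => // E;
  case: Hj; rewrite E.
Qed.

Lemma saturateS k : saturate (saturate k).+1 = saturate k.+1.
Proof. by apply: val_inj; rewrite /saturate /= !inordK; lia. Qed.

Lemma hole_letter_saturate a k : hole_letter a (saturate k) = hole_letter a k.
Proof.
rewrite /hole_letter /saturate inordK; last by lia.
by have := ltn_ord a; case: eqP => ?; case: eqP => ? //; lia.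
Qed.

(** One round trip: mark the symbol, carry it to the first blank behind the output, write it, return
    to the mark. *)
Lemma copy_symbol p k f out i : (i < n)%N -> nth hash rom_word i != hash ->
  reaches (config (Copy p (saturate k)) i%:Z (tape f None out))
    (config (Copy p (saturate (k + (nth hash rom_word i == hole))%N)) i.+1%:Z
       (tape f None (out ++ fill p k [:: nth hash rom_word i]))).
Proof.
move=> iN; set s := nth hash rom_word i => Hs.
pose k' := saturate (k + (s == hole))%N.
pose s' := if s == hole then symbol_of_letter (hole_letter p k) else s.
have -> : out ++ fill p k [:: s] = rcons out (letter_of_symbol s').
  by rewrite -cats1 /= /s'; case: eqP; rewrite ?symbol_of_letterK.
apply: (@reaches_trans _ _ (config (Carry p k' s') i.+1%:Z (tape f (Some i) out))).
  have -> : i.+1%:Z = shift MoveRight i%:Z by rewrite /=; lia.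
  apply: (@reaches_write _ machine _ _ _ _ (blank, Some (s, (i < f)%N, true))) => //.
    rewrite tape_in // /= -/s (negbTE Hs) /k' /s'; case: eqP => _ /=.
      by rewrite hole_letter_saturate saturateS addn1.
    by rewrite addn0.
  by move=> x; apply: tape_mark.
set e := (n + size out)%N.
apply: (@reaches_trans _ _ (config (Carry p k' s') e%:Z (tape f (Some i) out))).
  have -> : e%:Z = i.+1%:Z + (e - i.+1)%N%:Z by rewrite /e; lia.
  apply: reaches_right => // j Hj; have -> : i.+1%:Z + j%:Z = (i.+1 + j)%N by lia.
  case: (ltnP (i.+1 + j) n) => Hn; first by rewrite tape_in.
  by rewrite -(subnKC Hn) tape_out /= embed_written leqNgt ifN //; rewrite /e in Hj *; lia.
apply: (@reaches_trans _ _ (config (Return p k') (e%:Z - 1) (tape f (Some i) (rcons out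
  (letter_of_symbol s'))))).
  apply: (@reaches_write _ machine _ _ _ _ (write_letter (letter_of_symbol s'), None)
    MoveLeft) => //.
    by rewrite /e tape_out /= embed_written leqnn.
  by move=> x; apply: tape_rcons.
apply: (@reaches_trans _ _ (config (Return p k') i%:Z (tape f (Some i) (rcons out
  (letter_of_symbol s'))))).
  have -> : i%:Z = e%:Z - 1 - (e - 1 - i)%N%:Z by rewrite /e; lia.
  apply: reaches_left => // j Hj;
    have -> : e%:Z - 1 - j%:Z = (e - 1 - j)%N by rewrite /e in Hj *; lia.
  case: (ltnP (e - 1 - j) n) => Hn; last by rewrite -(subnKC Hn) tape_out.
  rewrite tape_in //=; have -> : (Some i == Some (e - 1 - j)%N) = false by apply/eqP => -[E];
    lia.
  by [].
have -> : i.+1%:Z = shift MoveRight i%:Z by rewrite /=; lia.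
apply: (@reaches_write _ machine _ _ _ _ (blank, Some (s, (i < f)%N, false))) => //.
  by rewrite tape_in // eqxx.
by move=> x; apply: tape_unmark.
Qed.

Lemma fill_cat a k s t :
  fill a k (s ++ t) = fill a k s ++ fill a (k + count_mem hole s) t.
Proof.
elim: s k => [|x s IH] k /=; first by rewrite addn0.
by case: eqP => _; rewrite IH ?addnS ?addSn ?add0n // addnA addn1.
Qed.

Lemma copy_segment p k f out pre s post : rom_word = pre ++ s ++ hash :: post ->
  hash \notin s ->
  reaches (config (Copy p (saturate k)) (size pre)%:Z (tape f None out))
    (config RewindNext ((size pre + size s)%N%:Z - 1) (tape f None (out ++ fill p k s))).
Proof.
elim: s k out pre => [|x s IH] k out pre E Hs.
  rewrite cats0 addn0.
  have iN : (size pre < n)%N by rewrite E size_cat /=; lia.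
  apply: (@reaches_move _ machine _ _ _ _ MoveLeft) => //.
  by rewrite tape_in //= E nth_cat ltnn subnn eqxx.
move: Hs; rewrite inE negb_or eq_sym => /andP [xh Hs].
have iN : (size pre < n)%N by rewrite E size_cat /=; lia.
have Ex : nth hash rom_word (size pre) = x by rewrite E nth_cat ltnn subnn.
have := copy_symbol p k f out iN; rewrite Ex => /(_ xh) H; apply: (reaches_trans H).
have := IH (k + (x == hole))%N (out ++ fill p k [:: x]) (rcons pre x).
have Ef : fill p k (x :: s) = fill p k [:: x] ++ fill p (k + (x == hole)) s.
  by rewrite -cat1s fill_cat [count_mem _ _]/= addn0.
rewrite Ef size_rcons -catA addSnnS; apply=> //.
by rewrite cat_rcons.
Qed.

Lemma rewind_next h f out : (h < n)%N ->
  reaches (config RewindNext (h%:Z - 1) (tape f None out)) (config Next 0 (tape f None out)).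
Proof.
move=> hn; apply: (@reaches_trans _ _ (config RewindNext (-1) (tape f None out))).
  have E : h%:Z - 1 - h%:Z = -1 by lia.
  rewrite -[X in reaches _ (config _ X _)]E; apply: reaches_left => // i ih;
    have -> : h%:Z - 1 - i%:Z = (h - 1 - i)%N by lia.
  by rewrite tape_in //; lia.
exact: (@reaches_move _ machine _ _ _ _ MoveRight).
Qed.

Lemma next_flagged f out : (f <= n)%N ->
  reaches (config Next 0 (tape f None out)) (config Next f%:Z (tape f None out)).
Proof.
move=> fn; rewrite -[f%:Z]add0r; apply: reaches_right => // i fi.
by rewrite add0r tape_in ?fi //; lia.
Qed.

Lemma template_round f h out : (h < n)%N -> (f < n)%N ->
  reaches (config RewindNext (h%:Z - 1) (tape f None out))
    (config RewindNext ((size tmpl)%:Z - 1)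
       (tape f.+1 None (out ++ fill (nth hash rom_word f) 0 tmpl))).
Proof.
move=> hn fn; set p := nth hash rom_word f.
apply: reaches_trans (rewind_next f out hn) _.
apply: reaches_trans (next_flagged out (ltnW fn)) _.
apply: (@reaches_trans _ _ (config (Rewind p) (f%:Z - 1) (tape f.+1 None out))).
  apply: (@reaches_write _ machine _ _ _ _ (blank, Some (p, true, false)) MoveLeft) => //.
    by rewrite tape_in // ltnn.
  by move=> x; apply: tape_flag.
apply: (@reaches_trans _ _ (config (Rewind p) (-1) (tape f.+1 None out))).
  have E : f%:Z - 1 - f%:Z = -1 by lia.
  rewrite -[X in reaches _ (config _ X _)]E; apply: reaches_left => // i fi;
    have -> : f%:Z - 1 - i%:Z = (f - 1 - i)%N by lia.
  by rewrite tape_in //; lia.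
apply: (@reaches_trans _ _ (config (Copy p (saturate 0)) 0 (tape f.+1 None out))).
  exact: (@reaches_move _ machine _ _ _ _ MoveRight).
exact: (@copy_segment p 0 f.+1 out [::] tmpl _ erefl tmpl_hash).
Qed.

(** The position [h] is general because the first round starts from the second [hash], where copying
    the header ended, and later rounds from the first. *)
Lemma template_rounds f h out : (h < n)%N -> (f <= n)%N ->
  exists2 h', (h' < n)%N &
  reaches (config RewindNext (h%:Z - 1) (tape f None out))
    (config RewindNext (h'%:Z - 1)
       (tape n None (out ++ flatten [seq fill a 0 tmpl | a <- drop f rom_word]))).
Proof.
move=> hn fn; rewrite -(subKn fn); move: (n - f)%N (leq_subr f n) => m mn.
elim: m h out hn mn => [|m IH] h out hn mn.
  by exists h => //; rewrite subn0 drop_size cats0; apply: reaches_refl.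
have tn : (size tmpl < n)%N by rewrite size_cat /=; lia.
have fn' : (n - m.+1 < n)%N by lia.
have [h' h'n H] := IH (size tmpl) (out ++ fill (nth hash rom_word (n - m.+1)) 0 tmpl) tn
  (ltnW mn).
exists h' => //; apply: reaches_trans (template_round _ hn fn') _.
have E : (n - m.+1).+1 = (n - m)%N by lia.
by rewrite E (drop_nth hash fn') E /= catA.
Qed.

Definition output_word : seq letter :=
  hdr ++ flatten [seq fill a 0 tmpl | a <- rom_word] ++ chip_code.

Lemma write_suffix_letter (j : 'I_5) out : j != ord_max ->
  reaches (config (Suffix j) (n + size out)%N%:Z (tape n None out))
    (config (Suffix (inord j.+1)) (n + size out).+1%:Z
       (tape n None (rcons out (nth Separator chip_code j)))).
Proof.
move=> /negbTE j4;
  have -> : (n + size out).+1%:Z = shift MoveRight (n + size out)%N%:Z by rewrite /=; lia.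
apply: (@reaches_write _ machine _ _ _ _ (write_letter (nth Separator chip_code j), None)) =>
  //.
  by rewrite tape_out /= embed_written leqnn j4.
by move=> x; apply: tape_rcons.
Qed.

Lemma write_suffix out :
  reaches (config (Suffix ord0) (n + size out)%N%:Z (tape n None out))
    (config Back (n + size out + 3)%N%:Z (tape n None (out ++ chip_code))).
Proof.
have step j k out' : j = inord k :> 'I_5 -> (k < 4)%N ->
    reaches (config (Suffix j) (n + size out')%N%:Z (tape n None out'))
      (config (Suffix (inord k.+1)) (n + size (rcons out' (nth Separator chip_code k)))%N%:Z
       (tape n None (rcons out' (nth Separator chip_code k)))).
  move=> -> k4; rewrite size_rcons addnS -[in nth _ _ k](@inordK 4 k); last by lia.
  rewrite -[in k.+1](@inordK 4 k); last by lia.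
  by apply: write_suffix_letter; rewrite -val_eqE /= inordK; lia.
have i0 : ord0 = inord 0 :> 'I_5 by apply: val_inj; rewrite /= inordK.
apply: reaches_trans (step _ _ _ i0 isT) _.
apply: reaches_trans (step _ 1%N _ erefl isT) _.
apply: reaches_trans (step _ 2%N _ erefl isT) _.
apply: reaches_trans (step _ 3%N _ erefl isT) _.
set out4 := rcons _ _.
have -> : out ++ chip_code = rcons out4 Separator by rewrite /out4 -!cats1 -!catA.
have -> : (n + size out + 3)%N%:Z = shift MoveLeft (n + size out4)%N%:Z.
  by rewrite /out4 /= !size_rcons; lia.
have i4 : inord 4 == ord_max :> 'I_5 by rewrite -val_eqE /= inordK.
apply: (@reaches_write _ machine _ _ _ _ (write_letter Separator, None)) => //.
  by rewrite tape_out /= embed_written leqnn i4 inordK.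
by move=> x; apply: tape_rcons.
Qed.

Lemma back_to_output out k :
  reaches (config Back (n + k)%N%:Z (tape n None out))
    (config (Simulate (tm_start D)) n%:Z (tape n None out)).
Proof.
have n0 : (0 < n)%N by rewrite size_cat /=; lia.
apply: (@reaches_trans _ _ (config Back n.-1%:Z (tape n None out))).
  have -> : n.-1%:Z = (n + k)%N%:Z - k.+1%:Z by lia.
  apply: reaches_left => // i ik; have -> : (n + k)%N%:Z - i%:Z = (n + (k - i))%N by lia.
  by rewrite tape_out.
have -> : n%:Z = shift MoveRight n.-1%:Z by rewrite /=; lia.
by apply: (@reaches_move _ machine) => //; rewrite tape_in // prednK.
Qed.

Lemma tape_init : tm_init machine rom_word = config Seek 0 (tape 0 None [::]).
Proof.
congr (TMConfig _ _ _); apply: functional_extensionality => -[i|i] //.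
rewrite /tape /=; case: ltnP => iN; last by rewrite !onth_default.
by rewrite onthE (nth_map hash) // /track_embed.
Qed.

Lemma reaches_simulation :
  reaches (tm_init machine rom_word) (config (Simulate (tm_start D)) n%:Z (tape n None
    output_word)).
Proof.
rewrite tape_init; pose pre := rcons tmpl hash; pose s := map symbol_of_letter hdr.
have E : rom_word = pre ++ s ++ hash :: rest by rewrite /rom_word /pre cat_rcons.
have tn : (size tmpl < n)%N by rewrite size_cat /=; lia.
apply: (@reaches_trans _ _ (config Seek (size tmpl)%:Z (tape 0 None [::]))).
  rewrite -[(size tmpl)%:Z]add0r; apply: reaches_right => // i it.
  rewrite add0r tape_in /=; last by lia.
  rewrite /rom_word nth_cat it ifN //.
  by apply: contra tmpl_hash => /eqP <-; apply: mem_nth.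
apply: (@reaches_trans _ _ (config (Copy final (saturate 0)) (size pre)%:Z (tape 0 None [::]))).
  have -> : (size pre)%:Z = shift MoveRight (size tmpl)%:Z by rewrite /pre size_rcons /=; lia.
  apply: (@reaches_move _ machine) => //.
  by rewrite tape_in //= nth_cat ltnn subnn eqxx.
apply: reaches_trans (copy_segment final 0 0 [::] E _) _.
  exact: notin_letters.
have -> : [::] ++ fill final 0 s = hdr.
  by rewrite /s -[map _ _]cats0 fill_letters cats0.
have hn : (size pre + size s < n)%N by rewrite E !size_cat /=; lia.
have [h' h'n H] := template_rounds hdr hn (leq0n n).
apply: (reaches_trans H); rewrite drop0.
apply: reaches_trans (rewind_next _ _ h'n) _.
apply: reaches_trans (next_flagged _ (leqnn n)) _.
set out := hdr ++ _.
apply: (@reaches_trans _ _ (config (Suffix ord0) n%:Z (tape n None out))).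
  by apply: (@reaches_move _ machine _ _ _ _ Stay) => //; rewrite -[n]addn0 tape_out.
apply: (@reaches_trans _ _ (config (Suffix ord0) (n + size out)%N%:Z (tape n None out))).
  rewrite PoszD; apply: reaches_right => // i io.
  have -> : n%:Z + i%:Z = (n + i)%N by lia.
  by rewrite tape_out /= embed_written leqNgt io.
apply: reaches_trans (write_suffix _) _; rewrite -addnA /out -catA -/output_word.
exact: back_to_output.
Qed.

(** The tape of [D] is the first track with origin at cell [n]. The second track stays as the
    writing left it, and under the input the first track is blank, as [D] expects to the left of its
    word. *)
Definition simulation (c : tm_config D) : tm_config machine :=
  config (Simulate (cfg_state c)) (cfg_head c + n%:Z)
    (fun x => (cfg_tape c (x - n%:Z), (tape n None [::] x).2)).

Lemma simulation_init :
  simulation (tm_init D output_word) = config (Simulate (tm_start D)) n%:Z (tape n None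
    output_word).
Proof.
rewrite /simulation /= add0r; congr (TMConfig _ _ _).
apply: functional_extensionality => x; have [xn|xn] := boolP (x < n%:Z).
  have -> : (if x - n%:Z is Posz i then onth output_word i else None) = None.
    by case E: (x - n%:Z) => [i|i] //; lia.
  case: x xn => // i xn; have iN : (i < n)%N by lia.
  by rewrite !tape_in.
have -> : x = (n + absz (x - n%:Z)%R)%N by lia.
rewrite !tape_out; congr (tm_embed D _, _).
by have -> : (n + absz (x - n%:Z)%R)%N%:Z - n%:Z = (absz (x - n%:Z)%R)%:Z by lia.
Qed.

Lemma simulation_step c : reaches (simulation c) (simulation (tm_step c)).
Proof.
rewrite /tm_step; case: ifP => Hc; first exact: reaches_refl.
case Ed: (tm_delta _ _) => [[q a] d].
have -> : simulation (TMConfig q (shift d (cfg_head c))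
    (fun i => if i == cfg_head c then a else cfg_tape c i)) =
  config (Simulate q) (shift d (cfg_head c + n%:Z))
    (fun x => (if x - n%:Z == cfg_head c then a else cfg_tape c (x - n%:Z),
       (tape n None [::] x).2)).
  by congr (TMConfig _ _ _); case: d {Ed} => /=; lia.
apply: (@reaches_write _ machine _ _ _ _ (a, (tape n None [::] (cfg_head c + n%:Z)).2)) => //.
  rewrite /= addrK; move: Hc; rewrite /tm_halted; case: ifP => //= _; case: ifP => //= _.
  by rewrite Ed.
move=> x; have -> : (x == cfg_head c + n%:Z) = (x - n%:Z == cfg_head c) by lia.
by case: eqP => // <-; rewrite subrK.
Qed.

Lemma simulation_iter k c : reaches (simulation c) (simulation (iter k (@tm_step _ D) c)).
Proof.
elim: k => [|k IH]; first exact: reaches_refl.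
exact: reaches_trans IH (simulation_step _).
Qed.

Lemma machine_accepts : tm_accepts D output_word ->
  exists k, tm_halted (iter k (@tm_step _ machine) (tm_init machine rom_word)).
Proof.
case=> k Hk; set c := iter _ _ _ in Hk.
suff [c' [[l <-] Hc']] : exists c', reaches (tm_init machine rom_word) c' /\ tm_halted c'.
  by exists l.
exists (tm_step (simulation c)); split.
  apply: reaches_trans reaches_simulation _; rewrite -simulation_init.
  apply: reaches_trans (simulation_iter k _) _; by exists 1%N.
by rewrite /tm_step /= Hk eqxx.
Qed.

(** A rejecting configuration of [D] becomes a fixed point that is not halting. *)
Lemma machine_rejects : tm_rejects D output_word ->
  forall k, ~~ tm_halted (iter k (@tm_step _ machine) (tm_init machine rom_word)).
Proof.
case=> k Hk; set c := iter _ _ _ in Hk.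
have Hr : reaches (tm_init machine rom_word) (simulation c).
  by apply: reaches_trans reaches_simulation _; rewrite -simulation_init;
    apply: simulation_iter.
apply: (reaches_fixed Hr) => //.
rewrite /tm_step /= Hk eqxx eq_sym (negbTE (tm_accept_neq_reject D)) /simulation Hk.
by congr (TMConfig _ _ _); apply: functional_extensionality => x; case: eqP => // ->.
Qed.

End Run.
End Machine.

(** * Diagonalisation *)

Lemma size_positive_bits p : (2 ^ (size (positive_bits p)).-1 <= nat_of_pos p)%N.
Proof.
have H q : (2 ^ size (positive_bits q) = 2 * 2 ^ (size (positive_bits q)).-1)%N.
  by rewrite -expnS prednK //; case: q.
by elim: p => [p IH|p IH|] //=; rewrite NatTrec.doubleE H; lia.
Qed.

Lemma size_nat_bits n k : (n < 2 ^ k)%N -> (size (nat_bits n) <= k)%N.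
Proof.
rewrite /nat_bits; have := bin_of_natK n; case: bin_of_nat => [|p] //= <- pk.
have := leq_ltn_trans (size_positive_bits p) pk.
rewrite ltn_exp2l //; lia.
Qed.

(* The header contains the length of the input, which contains the header: the
   input is padded to a length that is large enough to fit. *)
Lemma nat_bits_slow (a c : nat) : exists n, (size (nat_bits (a * n)) + c <= n)%N.
Proof.
(* For [n = 2 ^ k] the numeral of [a * n] has at most [a + k] digits, and
   [a + k + c = 2 * (a + c) + 1] is below [2 ^ k]. *)
pose k := (a + c).+1; exists (2 ^ k)%N.
have Hs : (size (nat_bits (a * 2 ^ k)) <= a + k)%N.
  apply: size_nat_bits; rewrite expnD ltn_pmul2r ?expn_gt0 //; exact: ltn_expl.
apply: (@leq_trans (a + k + c)); first by rewrite leq_add2r.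
rewrite /k expnS; have := ltn_expl (a + c) (isT : 1 < 2)%N; lia.
Qed.

Lemma size_encode_nat (n : nat) : size (encode_int n) = (size (nat_bits n)).+1.
Proof. by rewrite /encode_int size_cat /= add0n size_cat /= addn1. Qed.

Lemma header_padding (M : turing_machine symbol) (c : nat) :
  exists n, (size (header M n) + c <= n)%N.
Proof.
pose r := size (encode_int (depth (num_vars M)) ++ encode_int 6).
have [n Hn] := nat_bits_slow (width (program final M)) (r + c + 1).
by exists n; rewrite /header size_cat -/r size_encode_nat; lia.
Qed.

Theorem theorem3 :
  undecidable encode
    (fun I : pf_config => infinitely_many_topplings (pf_initial I)).
Proof.
case=> D HD; pose M := machine D; pose t := template M.
(* The 3 counts two separators [hash] and the letter [final]. *)
have [n Hn] := header_padding M (size t + 3).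
pose m := (n - (size (header M n) + (size t + 3)))%N.
(* The header is written for the length [n] that the padding then gives to the whole input. *)
pose u := t ++ hash :: map symbol_of_letter (header M n) ++ hash :: nseq m hash.
have u_final : final \notin u.
  by rewrite !(mem_cat, inE) !negb_or notin_template // notin_letters // mem_nseq andbF.
have E : rcons u final = rom_word t (rcons (nseq m hash) final) (header M n).
  by rewrite /u /rom_word rcons_cat rcons_cons rcons_cat.
have Ew : size (rcons u final) = n.
  rewrite size_rcons !size_cat /= size_cat /= size_map size_nseq /m; lia.
(* The fixed point: on this input [M] writes the encoding of the configuration that simulates [M] on
   the same input. *)
have Henc : encode (instance M u) =
    output_word t (rcons (nseq m hash) final) (header M n).
  rewrite encode_instance Ew /output_word -E; congr (_ ++ (flatten _ ++ _)).
  by apply: eq_map => a; rewrite fill_template.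
have th : hash \notin t by apply: notin_template.
have Hinf := instance_infinite M u_final; rewrite E in Hinf.
have [[Hyes]|[Hno]] := HD (instance M u); rewrite Henc.
  case/(machine_accepts th) => k Hk.
  by have := proj1 Hinf Hyes k; rewrite Hk.
by move/(machine_rejects th) => Hk; apply/Hno/Hinf.
Qed.
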